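(* Let $0<\alpha<1$, $\beta>\alpha$ and $t,s>0$. Then for all $u>0$: (i) $$\left(\int_t^{t+s}-\int_0^s\right)\frac{(t+s-r)^{\beta-\alpha-1}}{\Gamma(\beta-\alpha)}\,\psi_{\alpha,\beta-\alpha}(r,u)\,dr=\frac{\alpha}{\Gamma(1-\alpha)}\int_0^t\int_0^s\frac{\left(\psi_{\alpha,\beta-\alpha}(r_1,\cdot)*\psi_{\alpha,\beta-\alpha}(r_2,\cdot)\right)(u)}{(t+s-r_1-r_2)^{1+\alpha}}\,dr_1\,dr_2;$$ (ii) $$\psi_{\alpha,0}(t+s,u)=\frac{\alpha}{\Gamma(1-\alpha)}\int_0^t\int_0^s\frac{\left(\psi_{\alpha,0}(r_1,\cdot)*\psi_{\alpha,0}(r_2,\cdot)\right)(u)}{(t+s-r_1-r_2)^{1+\alpha}}\,dr_1\,dr_2.$$ In both double integrals one of the variables $r_1,r_2$ ranges over $(0,t)$ and the other over $(0,s)$ (the integrand is symmetric in $r_1,r_2$).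
   Context: $\left(\int_t^{t+s}-\int_0^s\right)F(r)\,dr$ means $\int_t^{t+s}F(r)\,dr-\int_0^sF(r)\,dr$. The convolution, taken in the second variable, is $(f*h)(u)=\int_0^u f(u-v)h(v)\,dv$. Wright function: for $\lambda>-1$, $\mu\in\mathbb{C}$, $W_{\lambda,\mu}(z):=\sum_{n=0}^\infty \frac{z^n}{n!\,\Gamma(\lambda n+\mu)}$, $z\in\mathbb{C}$ (with $1/\Gamma=0$ at the poles of $\Gamma$). Scaled Wright function: for $0<\alpha<1$, $\beta\ge0$, $\psi_{\alpha,\beta}(t,s):=t^{\beta-1}W_{-\alpha,\beta}(-st^{-\alpha})$, $t>0$, $s\in\mathbb{C}$. *)

(* Defs.v *)
From HB Require Import structures.
From mathcomp Require Import all_boot all_order all_algebra.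
From mathcomp Require Import all_classical all_reals all_analysis.

Set Implicit Arguments.
Unset Strict Implicit.
Unset Printing Implicit Defensive.

Import Order.TTheory GRing.Theory Num.Theory.
Import numFieldNormedType.Exports.

Local Open Scope classical_set_scope.
Local Open Scope ring_scope.

(* Euler's integral; it represents the Gamma function for 0 < x only. *)
Definition euler_integral {R : realType} (x : R) : R :=
  \int[lebesgue_measure]_(r in `]0, +oo[) (r `^ (x - 1) * expR (- r)).

(* The Gamma function on the real line, extended to x <= 0 through
   Gamma x = Gamma (x + n) / (x (x + 1) ... (x + n - 1)) with x + n > 0.
   At the poles 0, -1, -2, ... the product vanishes, so that Gamma x = 0 and
   (Gamma x)^-1 = 0, the usual value of 1/Gamma there. *)
Definition Gamma {R : realType} (x : R) : R :=
  if 0 < x then euler_integral x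
  else let n := (Num.truncn (- x)).+1 in
       euler_integral (x + n%:R) / \prod_(k < n) (x + k%:R).

(* Real parameters and real argument; the series converges for lambda > -1. *)
Definition wright {R : realType} (lambda mu z : R) : R :=
  limn (series (fun n : nat =>
    z ^+ n / n`!%:R * (Gamma (lambda * n%:R + mu))^-1)).

Definition scaled_wright {R : realType} (alpha beta t s : R) : R :=
  t `^ (beta - 1) * wright (- alpha) beta (- (s * t `^ (- alpha))).

(* The value is in \bar R so that no default value is substituted for a
   divergent integral. *)
Definition convolution {R : realType} (f h : R -> R) (u : R) : \bar R :=
  (\int[lebesgue_measure]_(v in `]0%R, u[) (f (u - v) * h v)%:E)%E.

Definition wright_double_integral {R : realType} (alpha b t s u : R) : \bar R :=
  (\int[lebesgue_measure]_(r1 in `]0%R, t[)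
     \int[lebesgue_measure]_(r2 in `]0%R, s[)
       (convolution (scaled_wright alpha b r1) (scaled_wright alpha b r2) u
        * ((t + s - r1 - r2) `^ (1 + alpha))^-1%:E))%E.

(* Main.v *)
Require Import Defs.
From HB Require Import structures.
From mathcomp Require Import all_boot all_order all_algebra.
From mathcomp Require Import all_classical all_reals all_analysis.
From mathcomp Require Import measurable_realfun ring lra zify.

Set Implicit Arguments.
Unset Strict Implicit.
Unset Printing Implicit Defensive.

Import Order.TTheory GRing.Theory Num.Theory.
Import numFieldNormedType.Exports.

Local Open Scope classical_set_scope.
Local Open Scope ring_scope.

(** Both identities are first-passage decompositions. In t, scaled_wright alpha
    b t u has Laplace transform z^(-b) exp (- u z^alpha): for b = 0 it is the
    density at time u of the alpha-stable subordinator, whose jumps have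
    intensity alpha / Gamma (1 - alpha) y^(-1 - alpha) dy. The double integral
    sums over the position r1 < t reached before the jump over the level t and
    over the distance r2 < s that remains to be covered after that jump.

    The proof works with a discrete model in which every step is a finite sum.
    The power z^alpha becomes (1 - X)^alpha, and the densities become the
    coefficients stable_coef alpha b k w of X^k in
    (1 - X)^(-b) exp (- w (1 - X)^alpha). By Newton's binomial identity
    (rising_coefD), their derivative in w is minus their convolution with the
    coefficients of (1 - X)^alpha. Hence, with M = p + q - 1, the derivative of
    v |-> sum_(i < q) a_i(v) a_(M - i)(u - v) is a difference of two convolution
    sums in which all terms cancel except those with i < q and l < p
    (convolution_exchange). Integrating in v gives discrete_identity, the exact
    discrete form of both identities; the values of the sum at v = 0 and v = u
    yield the left-hand sides, since at w = 0 the coefficients are those of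
    (1 - X)^(-b).

    It remains to let the mesh 1 / (n + 1) tend to 0, with p and q the cell
    numbers of t and s. Pointwise, (n + 1)^(1 - b) a_k(v (n + 1)^alpha) with
    k / (n + 1) -> r tends to scaled_wright alpha b r v (stable_coef_cvg). Term
    by term in the power series in v this is the Gauss limit
    (k + 1)^(1 - y) rising_coef y k -> 1 / Gamma y for all real y (gauss_limit),
    and the terms are dominated because alpha < 1 makes (alpha m)^(alpha m) / m!
    superexponentially small.

    The sums are integrals of step functions (step_dominated_convergence), and
    the domination near r = 0, where the Wright series says nothing, comes from
    the discrete model as well. The coefficients are nonnegative
    (stable_coef_ge0); for b >= 1 the one of index k decreases in w at rate at
    least c k^(-alpha) (stable_coef_le_exp), and a recurrence in k carries the
    resulting bound a_k(w) w^theta <= C (k + 1)^(b - 1 + alpha theta) down to all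
    b >= 0 (stable_coef_le). With theta = 1 / 2 this is integrable in v at both
    ends of the convolution and gains r^(alpha / 2), which is what makes r^(b - 1)
    integrable at 0 when b = 0. *)

(** * Coefficients of the powers of 1 - X *)

Section rising_coef.
Context {R : realType}.
Implicit Types (x y z : R) (k n : nat).

(** The coefficient of X^k in (1 - X)^(-y). *)
Definition rising_coef y k : R := (\prod_(j < k) (y + j%:R)) / k`!%:R.

Lemma rising_coef0 y : rising_coef y 0 = 1.
Proof. by rewrite /rising_coef big_ord0 fact0 divr1. Qed.

Lemma rising_coefS y k :
  k.+1%:R * rising_coef y k.+1 = (y + k%:R) * rising_coef y k.
Proof.
rewrite /rising_coef big_ord_recr/= factS natrM.
have := fact_gt0 k; rewrite -(ltr_nat R) => k0.
by field; rewrite !gt_eqF// pnatr_eq0.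
Qed.

Lemma rising_coef_shift y k :
  k.+1%:R * rising_coef y k.+1 = y * rising_coef (y + 1) k.
Proof.
rewrite /rising_coef big_ord_recl/= factS natrM addr0.
under eq_bigr do rewrite /bump/= add1n -natr1 addrA addrAC.
have := fact_gt0 k; rewrite -(ltr_nat R) => k0.
by field; rewrite !gt_eqF// pnatr_eq0.
Qed.

Lemma rising_coef_ge0 y k : 0 <= y -> 0 <= rising_coef y k.
Proof.
move=> y0; rewrite divr_ge0 ?ler0n// prodr_ge0// => j _.
by rewrite addr_ge0 ?ler0n.
Qed.

Lemma rising_coef_gt0 y k : 0 < y -> 0 < rising_coef y k.
Proof.
move=> y0; rewrite divr_gt0 ?ltr0n ?fact_gt0// prodr_gt0// => j _.
by rewrite ltr_wpDr ?ler0n.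
Qed.

Lemma rising_coef_0 k : rising_coef 0 k = (k == 0)%:R.
Proof.
case: k => [|k]; first by rewrite rising_coef0.
by rewrite /rising_coef big_ord_recl/= addr0 !mul0r.
Qed.

Lemma rising_coef_1 k : rising_coef 1 k = 1.
Proof.
elim: k => [|k IH]; first by rewrite rising_coef0.
apply: (@mulfI _ k.+1%:R); first by rewrite pnatr_eq0.
by rewrite rising_coefS IH !mulr1 addrC natr1.
Qed.

(** The product (1 - X)^(-y) (1 - X)^(-z): weighting the index k = j + (k - j)
    shows that both sides solve the recurrence rising_coefS. *)
Lemma rising_coefD y z k : rising_coef (y + z) k =
  \sum_(j < k.+1) rising_coef y j * rising_coef z (k - j).
Proof.
elim: k => [|k IH]; first by rewrite big_ord1 !rising_coef0 mulr1.
apply: (@mulfI _ k.+1%:R); first by rewrite pnatr_eq0.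
rewrite rising_coefS IH mulr_sumr mulr_sumr.
transitivity (\sum_(j < k.+2)
    (j%:R * rising_coef y j * rising_coef z (k.+1 - j) +
     (k.+1 - j)%:R * rising_coef z (k.+1 - j) * rising_coef y j)); last first.
  apply: eq_bigr => j _; rewrite natrB; last by rewrite -ltnS.
  by ring.
rewrite big_split/= [X in _ = X + _]big_ord_recl mul0r mul0r add0r.
rewrite [X in _ = _ + X]big_ord_recr/= subnn mul0r mul0r addr0 -big_split/=.
apply: eq_bigr => j _.
rewrite /bump/= add1n subSS (subSn (ltn_ord j : (j <= k)%N)) !rising_coefS.
have jk : (j <= k)%N by rewrite -ltnS.
by rewrite natrB//; ring.
Qed.

Lemma rising_coef_nonincr y k n : 0 <= y <= 1 -> (k <= n)%N ->
  rising_coef y n <= rising_coef y k.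
Proof.
move=> /andP[y0 y1] /subnK <-; elim: (n - k)%N => [//|m]; apply: le_trans.
rewrite addSn -(@ler_pM2l _ (m + k).+1%:R) ?ltr0n// rising_coefS.
by rewrite ler_wpM2r ?rising_coef_ge0// -natr1 addrC lerD2l.
Qed.

(** The numbers - rising_coef (- a) k with k >= 1 are the probabilities of the
    Sibuya law, the jump law of the discrete stable process. *)
Lemma rising_coefN_le0 (a : R) k : 0 <= a <= 1 -> rising_coef (- a) k.+1 <= 0.
Proof.
move=> /andP[a0 a1]; rewrite -(pmulr_rle0 _ (ltr0Sn _ k)) rising_coef_shift.
by rewrite mulNr oppr_le0 mulr_ge0// rising_coef_ge0// addrC subr_ge0.
Qed.

Lemma ler_exp_fact (x : R) k : 0 <= x -> x ^+ k <= k`!%:R * expR x.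
Proof.
move=> x0; case: k => [|k]; first by rewrite expr0 fact0 mul1r -expR0 ler_expR.
rewrite mulrC -ler_pdivrMr ?ltr0n ?fact_gt0//.
by have := expR_ge1Dxn k x0; apply: le_trans; rewrite lerDr.
Qed.

Lemma rising_coef_bound y k : `|rising_coef y k| <= k`!%:R * expR (`|y| + 1).
Proof.
apply: (@le_trans _ _ ((`|y| + 1) ^+ k)); last first.
  by apply: ler_exp_fact; rewrite addr_ge0.
elim: k => [|k IH]; first by rewrite rising_coef0 expr0 normr1.
rewrite -(@ler_pM2l _ k.+1%:R) ?ltr0n//.
rewrite -[X in X * `|_|]ger0_norm ?ler0n// -normrM rising_coefS normrM.
rewrite exprS mulrA ler_pM//.
rewrite (le_trans (ler_normD _ _))// [`|k%:R|]ger0_norm ?ler0n//.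
rewrite -natr1 mulrDl mul1r mulrDr mulr1.
by have : 0 <= k%:R * `|y| :> R; [rewrite mulr_ge0|lra].
Qed.

End rising_coef.

(** * Exponential generating series *)

Section eser.
Context {R : realType}.
Implicit Types (c d : R^nat) (z : R).

Definition eser c z : R := limn (series (fun m => z ^+ m / m`!%:R * c m)).

(** A growth condition that gives the exponential series an infinite radius of
    convergence and survives shifts and multiplication by the index. *)
Definition geo_bounded c := exists A B : R, forall m, `|c m| <= A * B ^+ m.

Lemma geo_bounded_ge0 c : geo_bounded c ->
  exists A B : R, [/\ 0 <= A, 0 <= B & forall m, `|c m| <= A * B ^+ m].
Proof.
move=> [A [B H]]; exists `|A|, `|B|; split => // m.
by rewrite (le_trans (H m))// (le_trans (ler_norm _))// normrM normrX.
Qed.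

Lemma is_cvg_eser c z : geo_bounded c ->
  cvgn (series (fun m => z ^+ m / m`!%:R * c m)).
Proof.
move=> /geo_bounded_ge0[A [B [A0 B0 H]]]; apply: normed_cvg.
apply: (@series_le_cvg _ _ (A *: exp_coeff (`|z| * B))).
- by move=> m /=.
- move=> m; rewrite /= mulr_ge0// /exp_coeff/= divr_ge0 ?ler0n//.
  by rewrite exprn_ge0// mulr_ge0.
- move=> m; rewrite /=/exp_coeff/= !normrM normrX normfV.
  rewrite [`|_`!%:R|]ger0_norm ?ler0n//.
  rewrite [leRHS](_ : _ = `|z| ^+ m / m`!%:R * (A * B ^+ m)); last first.
    by rewrite -[LHS]/(A * ((`|z| * B) ^+ m / m`!%:R)) exprMn; ring.
  by rewrite ler_wpM2l// divr_ge0 ?ler0n ?exprn_ge0.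
- by apply: is_cvg_seriesZ; exact: is_cvg_series_exp_coeff.
Qed.

Lemma cvg_eser c z : geo_bounded c ->
  series (fun m => z ^+ m / m`!%:R * c m) @ \oo --> eser c z.
Proof. exact: is_cvg_eser. Qed.

Lemma geo_boundedD c d : geo_bounded c -> geo_bounded d ->
  geo_bounded (fun m => c m + d m).
Proof.
move=> /geo_bounded_ge0[A [B [A0 B0 H]]] /geo_bounded_ge0[A' [B' [A'0 B'0 H']]].
exists (A + A'), (B + B') => m; rewrite (le_trans (ler_normD _ _))//.
rewrite mulrDl lerD//.
  rewrite (le_trans (H m))// ler_wpM2l// lerXn2r ?nnegrE ?addr_ge0//.
  by rewrite lerDl.
rewrite (le_trans (H' m))// ler_wpM2l// lerXn2r ?nnegrE ?addr_ge0//.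
by rewrite lerDr.
Qed.

Lemma geo_boundedZ c (x : R) : geo_bounded c -> geo_bounded (fun m => x * c m).
Proof.
move=> [A [B H]]; exists (`|x| * A), B => m.
by rewrite normrM -mulrA ler_wpM2l.
Qed.

Lemma geo_bounded_shift c : geo_bounded c -> geo_bounded (fun m => c m.+1).
Proof.
by move=> [A [B H]]; exists (A * B), B => m; rewrite -mulrA -exprS.
Qed.

Lemma geo_boundedM_nat c : geo_bounded c -> geo_bounded (fun m => m%:R * c m).
Proof.
move=> /geo_bounded_ge0[A [B [A0 B0 H]]]; exists A, (2 * B) => m.
rewrite normrM ger0_norm// exprMn mulrCA ler_pM//.
by rewrite -natrX ler_nat ltnW// ltn_expl.
Qed.

Lemma eserD c d z : geo_bounded c -> geo_bounded d ->
  eser (fun m => c m + d m) z = eser c z + eser d z.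
Proof.
move=> hc hd; apply/cvg_lim => //.
rewrite (_ : (fun m => _) = (fun m => z ^+ m / m`!%:R * c m) +
    (fun m => z ^+ m / m`!%:R * d m)); last first.
  by apply/funext => m; rewrite mulrDr.
by rewrite seriesD; apply: cvgD; exact: cvg_eser.
Qed.

Lemma eserZ c (x : R) z : geo_bounded c ->
  eser (fun m => x * c m) z = x * eser c z.
Proof.
move=> hc; apply/cvg_lim => //.
rewrite (_ : (fun m => _) = x *: (fun m => z ^+ m / m`!%:R * c m)).
  by rewrite seriesZ; apply: cvgZr; exact: cvg_eser.
by apply/funext => m; rewrite mulrCA.
Qed.

Lemma eser_sum (I : Type) (r : seq I) (f : I -> R) (c : I -> R^nat) z :
  (forall i, geo_bounded (c i)) ->
  eser (fun m => \sum_(i <- r) f i * c i m) z = \sum_(i <- r) f i * eser (c i) z.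
Proof.
move=> hc.
suff : geo_bounded (fun m => \sum_(i <- r) f i * c i m) /\
    eser (fun m => \sum_(i <- r) f i * c i m) z =
    \sum_(i <- r) f i * eser (c i) z by case.
elim: r => [|i r [IH1 IH2]].
  have e : (fun m : nat => \sum_(i <- [::]) f i * c i m) = (fun=> 0).
    by apply/funext => m; rewrite big_nil.
  rewrite e big_nil; split.
    by exists 0, 0 => m; rewrite normr0 mul0r.
  apply/cvg_lim => //; rewrite (_ : (fun m => _) = (fun=> 0)); last first.
    by apply/funext => m; rewrite mulr0.
  rewrite (_ : series _ = (fun=> 0)); first exact: cvg_cst.
  by apply/funext => m; rewrite /series/= big1.
have e : (fun m : nat => \sum_(j <- i :: r) f j * c j m) =
    (fun m => f i * c i m + \sum_(j <- r) f j * c j m).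
  by apply/funext => m; rewrite big_cons.
rewrite e big_cons -IH2 -eserZ// -eserD//; last exact: geo_boundedZ.
by split=> //; apply: geo_boundedD => //; exact: geo_boundedZ.
Qed.

Lemma eser0 c : eser c 0 = c 0.
Proof.
apply/cvg_lim => //; rewrite -cvg_shiftS/=.
rewrite (_ : (fun n => _) = (fun=> c 0)); first exact: cvg_cst.
apply/funext => n; rewrite /series/= big_nat_recl//= big1 ?addr0.
  by rewrite expr0 fact0 divr1 mul1r.
by move=> m _; rewrite exprS mul0r mul0r mul0r.
Qed.

Lemma eserM_nat c z : geo_bounded c ->
  eser (fun m => m%:R * c m) z = z * eser (fun m => c m.+1) z.
Proof.
move=> hc; apply/cvg_lim => //; rewrite -cvg_shiftS/=.
rewrite (_ : (fun n => _) =
    z *: series (fun m => z ^+ m / m`!%:R * c m.+1)); last first.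
  apply/funext => n; rewrite /series/= big_nat_recl//= mul0r mulr0 add0r.
  rewrite -[RHS]/(z * _) mulr_sumr; apply: eq_bigr => m _.
  have m0 : m`!%:R != 0 :> R by rewrite pnatr_eq0 -lt0n fact_gt0.
  rewrite factS natrM exprS; field.
  by rewrite m0 addrC natr1 pnatr_eq0.
by apply: cvgZr; apply: cvg_eser; exact: geo_bounded_shift.
Qed.

Lemma eser_is_derive c z : geo_bounded c ->
  is_derive z 1 (eser c) (eser (fun m => c m.+1) z).
Proof.
move=> hc.
pose cc := fun c (m : nat) => c m / m`!%:R : R.
have E d x : pseries (cc d) x = series (fun m => x ^+ m / m`!%:R * d m).
  rewrite /pseries; congr series; apply/funext => m.
  by rewrite /cc/=; ring.
have Ed d : pseries_diffs (cc d) = cc (fun m => d m.+1).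
  apply/funext => m; rewrite /pseries_diffs /cc factS natrM.
  have m0 : m`!%:R != 0 :> R by rewrite pnatr_eq0 -lt0n fact_gt0.
  by field; rewrite m0 addrC natr1 pnatr_eq0.
have -> : eser c = (fun x => limn (pseries (cc c) x)).
  by apply/funext => x; rewrite E.
have -> : eser (fun m => c m.+1) z = limn (pseries (pseries_diffs (cc c)) z).
  by rewrite Ed E.
have hs := geo_bounded_shift hc.
apply: (@pseries_snd_diffs _ _ (`|z| + 1)); rewrite ?Ed ?E.
- exact: is_cvg_eser.
- exact: is_cvg_eser.
- by apply: is_cvg_eser; exact: geo_bounded_shift hs.
- by rewrite [ltRHS]ger0_norm ?addr_ge0// ltrDl.
Qed.

End eser.

(** * Dominated convergence and the improper fundamental theorem of calculus *)

Section integration_tools.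
Context d (T : measurableType d) (R : realType).
Variable mu : {measure set T -> \bar R}.

Lemma integrable_ge0_fin (D : set T) (f : T -> R) (l : R) : measurable D ->
  measurable_fun D f -> (forall x, D x -> 0 <= f x) ->
  (\int[mu]_(x in D) (f x)%:E = l%:E)%E -> mu.-integrable D (EFin \o f).
Proof.
move=> mD mf f0 fl; apply/integrableP; split; first by apply/measurable_EFinP.
have -> : (\int[mu]_(x in D) `|(EFin \o f) x| = \int[mu]_(x in D) (f x)%:E)%E.
  by apply: eq_integral => x /set_mem Dx; rewrite /= ger0_norm// f0.
by rewrite fl ltry.
Qed.

Lemma integrable_linear (D : set T) (f g : T -> R) (a b : R) : measurable D ->
  mu.-integrable D (EFin \o f) -> mu.-integrable D (EFin \o g) ->
  mu.-integrable D (EFin \o (fun r => a * f r + b * g r)).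
Proof.
move=> mD fi gi.
have := integrableD mD (integrableZl mD a fi) (integrableZl mD b gi).
by apply: eq_integrable.
Qed.

Lemma integrable_le (D : set T) (f g : T -> R) : measurable D ->
  measurable_fun D f -> (forall x, D x -> `|f x| <= g x) ->
  mu.-integrable D (EFin \o g) -> mu.-integrable D (EFin \o f).
Proof.
move=> mD mf fg; apply: le_integrable => //.
  by apply/measurable_EFinP; exact: mf.
by move=> x Dx; rewrite /= lee_fin (le_trans (fg _ Dx))// ler_norm.
Qed.

Lemma EFin_Rintegral (D : set T) (f : T -> R) : measurable D ->
  mu.-integrable D (EFin \o f) ->
  (\int[mu]_(x in D) f x)%:E = (\int[mu]_(x in D) (f x)%:E)%E.
Proof. by move=> mD fi; rewrite fineK// integrable_fin_num. Qed.

Lemma real_dominated_convergence (D : set T) (fn : nat -> T -> R) (f g : T -> R) :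
  measurable D -> (forall n, measurable_fun D (fn n)) ->
  (forall x, D x -> fn ^~ x @ \oo --> f x) ->
  mu.-integrable D (EFin \o g) ->
  (forall n x, D x -> `|fn n x| <= g x) ->
  mu.-integrable D (EFin \o f) /\
  (\int[mu]_(x in D) fn n x)%R @[n --> \oo] --> (\int[mu]_(x in D) f x)%R.
Proof.
move=> mD mfn cvf gi fg.
have mf : measurable_fun D f by apply: measurable_fun_cvg mfn cvf.
have [||||fi _ cv] := @dominated_convergence _ T R mu D mD
   (fun n => EFin \o fn n) (EFin \o f) (EFin \o g) _ _ _ gi.
- by move=> n; apply/measurable_EFinP; exact: mfn.
- by apply/measurable_EFinP; exact: mf.
- by apply: aeW => x Dx; apply: cvg_EFin; [by apply: nearW|exact: cvf].
- by apply: aeW => x n Dx; rewrite /= lee_fin fg.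
split=> //; apply: fine_cvg; rewrite fineK//; exact: integrable_fin_num.
Qed.

End integration_tools.

Section improper_FTC.
Context {R : realType}.
Notation mu := (@lebesgue_measure R).

(** The integrand may be unbounded at both ends: the interval is exhausted by
    closed subintervals, and f >= 0 makes the integrals converge. *)
Lemma ge0_FTC_itvoo (f F : R -> R) (a b : R) : a < b ->
  (forall x, a < x < b -> 0 <= f x) ->
  (forall x, a < x < b -> {for x, continuous f}) ->
  (forall x, a < x < b -> is_derive x 1 F (f x)) ->
  F x @[x --> a^'+] --> F a -> F x @[x --> b^'-] --> F b ->
  measurable_fun `]a, b[ f /\
  (\int[mu]_(x in `]a, b[) (f x)%:E = (F b - F a)%:E)%E.
Proof.
move=> ab f0 cf dF Fa Fb.
pose e (n : nat) := (b - a) / n.+3%:R.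
have ba : 0 < b - a by rewrite subr_gt0.
have e0 n : 0 < e n by rewrite divr_gt0.
have eba n : 2 * e n < b - a.
  by rewrite /e mulrA ltr_pdivrMr// mulrC ltr_pM2l// ltr_nat.
have cve : e @ \oo --> (0 : R).
  rewrite -[X in _ --> X](mulr0 (b - a)); apply: cvgMr.
  have := @cvg_harmonic R.
  by rewrite -(cvg_shiftS (@harmonic R)) -(cvg_shiftS (fun n => harmonic n.+1 : R)).
pose G n : set R := `[a + e n, b - e n]%classic.
have Gab n : G n `<=` `]a, b[.
  move=> x; rewrite /G/= !in_itv/= => /andP[ax xb].
  by rewrite (lt_le_trans _ ax) ?ltrDl// (le_lt_trans xb)// gtrBl.
have UG : `]a, b[%classic = \bigcup_n G n.
  apply/seteqP; split => [x|x [n _]]; last exact: Gab.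
  rewrite /= in_itv/= => /andP[ax xb].
  have m0 : 0 < Num.min (x - a) (b - x) by rewrite lt_min !subr_gt0 ax.
  move/cvgr0_norm_lt : (cve) => /(_ _ m0)[n _ H].
  have := H n (leqnn n); rewrite /= gtr0_norm// lt_min => /andP[h1 h2].
  by exists n => //; rewrite /G/= in_itv/=; apply/andP; split; lra.
have mf : measurable_fun `]a, b[ f.
  apply: open_continuous_measurable_fun => // x; rewrite inE/= in_itv/=.
  exact: cf.
split=> //.
apply: (cvg_unique _ (F := (fun n => (\int[mu]_(x in G n) (f x)%:E)%E) @ \oo)) => /=.
- exact: ereal_hausdorff.
- rewrite UG.
  have h := @ge0_nondecreasing_set_cvg_integral _ (measurableTypeR R) R G
    (EFin \o f) lebesgue_measure.
  apply: h.
  - apply/nondecreasing_seqP => n; apply/subsetPset => x; rewrite /G/= !in_itv/=.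
    have : e n.+1 <= e n.
      by rewrite /e ler_pM2l// lef_pV2 ?posrE// ler_nat.
    by move=> ? /andP[? ?]; apply/andP; split; lra.
  - by move=> n; exact: measurable_itv.
  - move=> n; apply/measurable_EFinP.
    by apply: measurable_funS mf => //; exact: Gab.
  - by move=> n x /Gab/=; rewrite in_itv/= lee_fin; exact: f0.
rewrite (_ : (fun n => _) = (fun n => (F (b - e n) - F (a + e n))%:E)); last first.
  apply/funext => n; have hn : a + e n < b - e n by have := eba n; lra.
  have inab x : x \in `]a + e n, b - e n[ -> a < x < b.
    rewrite in_itv/= => /andP[h1 h2]; have en0 := e0 n.
    by apply/andP; split; lra.
  have inab' x : a + e n <= x <= b - e n -> a < x < b.
    by move=> /andP[h1 h2]; have en0 := e0 n; apply/andP; split; lra.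
  rewrite /G (@continuous_FTC2 _ f F)//.
  - apply: continuous_in_subspaceT => x; rewrite inE/= in_itv/= => /inab'.
    exact: cf.
  - have cF x : a + e n <= x <= b - e n -> {for x, continuous F}.
      move=> /inab' /dF[dFx _]; apply: differentiable_continuous.
      exact/derivable1_diffP.
    split.
    + by move=> x /inab/dF[].
    + by apply: cvg_at_right_filter; apply: cF; rewrite lexx ltW.
    + by apply: cvg_at_left_filter; apply: cF; rewrite lexx ltW.
  - by move=> x /inab/dF[_ dFx]; rewrite derive1E.
apply: cvg_EFin; first by apply: nearW.
apply: cvgB.
- move/cvg_at_leftP : Fb; apply; split; first by move=> n; rewrite gtrBl.
  by rewrite -[X in _ --> X]subr0; apply: cvgB => //; exact: cvg_cst.
- move/cvg_at_rightP : Fa; apply; split; first by move=> n; rewrite ltrDl.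
  by rewrite -[X in _ --> X]addr0; apply: cvgD => //; exact: cvg_cst.
Qed.

End improper_FTC.

(** * Integrability of power functions *)

Section powR_integrals.
Context {R : realType}.
Notation mu := (@lebesgue_measure R).

Lemma continuous_powR (a x : R) : 0 < x -> {for x, continuous (fun r : R => r `^ a)}.
Proof.
move=> x0; apply: differentiable_continuous; apply/derivable1_diffP.
by apply: derivable_powR; rewrite in_itv/= x0.
Qed.

Lemma integral_powR (x T : R) : 0 < x -> 0 < T ->
  (\int[mu]_(r in `]0%R, T[) (r `^ (x - 1))%:E = (T `^ x / x)%:E)%E.
Proof.
move=> x0 T0.
have [|||||_ ->] := @ge0_FTC_itvoo _ (fun r => r `^ (x - 1))
  (fun r => x^-1 * r `^ x) 0 T T0; last first.
- by rewrite powR0 ?gt_eqF// mulr0 subr0 mulrC.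
- apply: cvg_at_left_filter; apply: cvgMr; exact: continuous_powR.
- by apply: cvgMr; rewrite powR0 ?gt_eqF//; exact: powR_cvg0.
- move=> r /andP[r0 _].
  have -> : r `^ (x - 1) = x^-1 * (x * r `^ (x - 1)) by rewrite mulKf ?gt_eqF.
  have h := is_derive1_powR x r0.
  exact: is_deriveZ.
- by move=> r /andP[r0 _]; exact: continuous_powR.
- by move=> r _; exact: powR_ge0.
Qed.

Lemma measurable_powR_subr (D : set R) (a p : R) :
  measurable_fun D (fun r => (a - r) `^ p).
Proof.
apply: measurable_funTS.
apply: (@measurableT_comp _ _ _ _ _ _ (fun r : R => r `^ p)).
  exact: measurable_powR.
by apply: measurable_funB.
Qed.

Lemma integrable_powR (x T : R) : 0 < x -> 0 < T ->
  mu.-integrable `]0, T[ (EFin \o (fun r => r `^ (x - 1))).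
Proof.
move=> x0 T0; apply: (integrable_ge0_fin _ _ _ (integral_powR x0 T0)) => //.
- by apply: measurable_funTS; exact: measurable_powR.
- by move=> r _; exact: powR_ge0.
Qed.

Lemma integrable_powR_onem (x T : R) : 0 < x -> 0 < T ->
  mu.-integrable `]0, T[ (EFin \o (fun r => (T - r) `^ (x - 1))).
Proof.
move=> x0 T0.
have d r : r < T ->
    is_derive r 1 (fun r => - (x^-1 * (T - r) `^ x)) ((T - r) `^ (x - 1)).
  move=> rT; have h := @is_derive1_powR R x (T - r).
  have {}h := h (ltac:(by rewrite subr_gt0)).
  have -> : (T - r) `^ (x - 1) = - (x^-1 * ((- 1) * (x * (T - r) `^ (x - 1)))).
    by rewrite mulN1r mulrN opprK mulKf ?gt_eqF.
  apply: is_deriveN; apply: is_deriveZ.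
  rewrite mulrC; apply: (@is_derive1_comp _ (fun r => r `^ x) (fun r => T - r)).
  rewrite -[X in is_derive _ _ _ X]sub0r.
  by apply: (@is_deriveB _ _ _ (cst T) id).
have [|||||mf If] := @ge0_FTC_itvoo _ (fun r => (T - r) `^ (x - 1))
  (fun r => - (x^-1 * (T - r) `^ x)) 0 T T0; last first.
  apply: (integrable_ge0_fin _ _ _ If) => //.
  by move=> r _; exact: powR_ge0.
- apply: cvgN; apply: cvgMr; rewrite subrr powR0 ?gt_eqF//.
  apply/cvg_at_leftP => v [vT vcv].
  have /cvg_at_rightP h := @powR_cvg0 R x x0.
  apply: (h (fun n => T - v n)); split=> [n|]; first by rewrite subr_gt0.
  by rewrite -[X in _ --> X](subrr T); apply: cvgB => //; exact: cvg_cst.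
- apply: cvg_at_right_filter.
  have cF : {for 0, continuous (fun r : R => - (x^-1 * (T - r) `^ x))}.
    have [h _] := d 0 T0.
    by apply: differentiable_continuous; apply/derivable1_diffP.
  exact: cF.
- by move=> r /andP[_ rT]; exact: d.
- move=> r /andP[_ rT].
  have h1 : (fun y : R => T - y) y @[y --> r] --> T - r.
    by apply: cvgB; [exact: cvg_cst|exact: cvg_id].
  have h2 : 0 < T - r by rewrite subr_gt0.
  exact: (cvg_comp _ _ h1 (@continuous_powR (x - 1) _ h2)).
- by move=> r _; exact: powR_ge0.
Qed.

(** A beta-type integrand: away from each endpoint the corresponding factor is
    bounded, whence domination by the sum of the two one-sided powers. *)
Lemma integrable_beta (x y T : R) : 0 < x <= 1 -> 0 < y <= 1 -> 0 < T ->
  mu.-integrable `]0, T[ (EFin \o (fun r => r `^ (x - 1) * (T - r) `^ (y - 1))).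
Proof.
move=> /andP[x0 x1] /andP[y0 y1] T0.
have T2 : 0 < T / 2 by rewrite divr_gt0.
pose g r := (T / 2) `^ (y - 1) * r `^ (x - 1) +
            (T / 2) `^ (x - 1) * (T - r) `^ (y - 1).
have gi : mu.-integrable `]0, T[ (EFin \o g).
  apply: integrable_linear => //; first exact: integrable_powR.
  exact: integrable_powR_onem.
apply: integrable_le gi => //.
  apply: measurable_funM.
    by apply: measurable_funTS; exact: measurable_powR.
  exact: measurable_powR_subr.
move=> r; rewrite /= in_itv/= => /andP[r0 rT].
have nincr a p q : 0 < p -> p <= q -> a <= 1 -> q `^ (a - 1) <= p `^ (a - 1).
  move=> p0 pq a1; rewrite -(opprB 1 a) !powRN lef_pV2 ?posrE ?powR_gt0//.
    by apply: ge0_ler_powR; rewrite ?nnegrE ?subr_ge0// ltW// (lt_le_trans p0).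
  exact: lt_le_trans p0 pq.
rewrite ger0_norm ?mulr_ge0 ?powR_ge0//.
rewrite /g.
have [rT2|rT2] := leP r (T / 2).
  rewrite ler_wpDr ?mulr_ge0 ?powR_ge0// mulrC ler_wpM2r ?powR_ge0//.
  by apply: nincr => //; lra.
rewrite ler_wpDl ?mulr_ge0 ?powR_ge0// ler_wpM2r ?powR_ge0//.
by apply: nincr => //; lra.
Qed.

End powR_integrals.

(** * The Gauss limit for 1 / Gamma *)

Section gauss_limit.
Context {R : realType}.
Notation mu := (@lebesgue_measure R).

(** Induction on n through (1 - v)^(n + 1) = (1 - v)^n - v (1 - v)^n. *)
Lemma beta_integral (x T : R) (n : nat) : 0 < x -> 0 < T ->
  mu.-integrable `]0, T[ (EFin \o (fun r => r `^ (x - 1) * (1 - r / T) ^+ n)) /\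
  (\int[mu]_(r in `]0, T[) (r `^ (x - 1) * (1 - r / T) ^+ n))%R =
  T `^ x / (n.+1%:R * rising_coef x n.+1).
Proof.
move=> + T0; elim: n x => [|n IH] x x0.
  have e : (fun r => r `^ (x - 1) * (1 - r / T) ^+ 0) = (fun r => r `^ (x - 1)).
    by apply/funext => r; rewrite expr0 mulr1.
  rewrite e; split; first exact: integrable_powR.
  rewrite /Rintegral integral_powR//= mul1r.
  by have := rising_coefS x 0; rewrite mul1r rising_coef0 addr0 mulr1 => ->.
have [i1 I1] := IH x x0; have [i2 I2] := IH (x + 1) (ltac:(lra)).
have e (r : R) : `]0, T[%classic r -> r `^ (x - 1) * (1 - r / T) ^+ n.+1 =
    1 * (r `^ (x - 1) * (1 - r / T) ^+ n) +
    (- T^-1) * (r `^ (x + 1 - 1) * (1 - r / T) ^+ n).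
  rewrite /= in_itv/= => /andP[r0 _].
  by rewrite addrK -[in RHS](@mulr_powRB1 _ r x) ?ltW// exprS; ring.
have mI : measurable (`]0, T[%classic : set (measurableTypeR R)) by [].
split.
  have := integrable_linear 1 (- T^-1) mI i1 i2.
  apply: eq_integrable => //.
  by move=> r /set_mem rT; rewrite /= e.
transitivity (\int[mu]_(r in `]0%R, T[)
  (1 * (r `^ (x - 1) * (1 - r / T) ^+ n) +
    (- T^-1) * (r `^ (x + 1 - 1) * (1 - r / T) ^+ n)))%R.
  by apply: eq_Rintegral => r /set_mem rT; rewrite e.
rewrite RintegralD//; last 2 first.
  exact: (integrableZl mI 1 i1).
  exact: (integrableZl mI (- T^-1) i2).
rewrite !RintegralZl// I1 I2.
have A := rising_coef_gt0 n.+1 x0.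
have B : 0 < rising_coef (x + 1) n.+1 by apply: rising_coef_gt0; lra.
have AB : (x + n.+1%:R) * rising_coef x n.+1 = x * rising_coef (x + 1) n.+1.
  by rewrite -rising_coefS rising_coef_shift.
rewrite (rising_coefS x n.+1) powRD; last by rewrite (gt_eqF T0) implybT.
rewrite powRr1 ?ltW//.
have -> : rising_coef (x + 1) n.+1 = (x + n.+1%:R) * rising_coef x n.+1 / x.
  by rewrite AB mulrAC divff ?gt_eqF// mul1r.
have n0 : 0 < n%:R + 1 :> R by rewrite natr1.
field; rewrite ?(gt_eqF x0) ?(gt_eqF T0) ?(gt_eqF A) -?natr1 ?gt_eqF//; lra.
Qed.

(** Near 0 the power is integrable; from 1 on it is at most m! 2^m exp (r / 2)
    for an integer m > x, which leaves half of the exponential decay. *)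
Lemma integrable_euler (x : R) : 0 < x ->
  mu.-integrable `]0, +oo[ (EFin \o (fun r => r `^ (x - 1) * expR (- r))).
Proof.
move=> x0.
pose m := (Num.truncn x).+1.
have xm : x < m%:R by rewrite truncnS_gt.
have i1 : mu.-integrable `]0, +oo[
    (EFin \o ((fun r => r `^ (x - 1)) \_ `]0, 1[)).
  apply: (@integrableS _ _ _ _ setT) => //.
  rewrite -restrict_EFin.
  have m01 : measurable (`]0, 1[%classic : set (measurableTypeR R)) by [].
  by apply/(integrable_mkcond _ m01).1; exact: integrable_powR.
have i2 : mu.-integrable `]0, +oo[ (EFin \o (exponential_pdf (2^-1 : R))).
  apply: (@integrableS _ _ _ _ setT) => //.
  by apply: integrable_exponential_pdf; rewrite invr_gt0.
have mI : measurable (`]0, +oo[%classic : set (measurableTypeR R)) by [].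
have i3 := integrable_linear 1 (2 * (m`!%:R * 2 ^+ m)) mI i1 i2.
apply: integrable_le i3 => //.
  apply: measurable_funM; first by apply: measurable_funTS; exact: measurable_powR.
  apply: (@measurableT_comp _ _ _ _ _ _ expR) => //.
move=> r; rewrite /= in_itv/= andbT => r0.
rewrite ger0_norm ?mulr_ge0 ?powR_ge0 ?expR_ge0// mul1r.
rewrite exponential_pdfE; last exact: ltW.
have E0 := expR_gt0 (- r).
have [r1|r1] := ltP r 1.
  rewrite patchE mem_set/= ?in_itv/= ?r0//.
  apply: (@le_trans _ _ (r `^ (x - 1))).
    rewrite -[leRHS]mulr1 ler_wpM2l ?powR_ge0// -expR0 ler_expR; lra.
  rewrite lerDl !mulr_ge0// ?expR_ge0// ?exprn_ge0//; lra.
rewrite patchE memNset/=; last by rewrite in_itv/= => /andP[_]; rewrite ltNge r1.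
rewrite add0r.
rewrite [leRHS](_ : _ = m`!%:R * 2 ^+ m * expR (- (2^-1) * r)); last by field.
have -> : - r = r / 2 * -1 + - (2^-1) * r by lra.
rewrite expRD mulrA ler_wpM2r ?expR_ge0//.
rewrite mulrN1 expRN ler_pdivrMr ?expR_gt0//.
apply: (@le_trans _ _ (r ^+ m)).
  rewrite -powR_mulrn; last exact: ltW.
  by rewrite ler_powR//; lra.
rewrite [leLHS](_ : _ = 2 ^+ m * (r / 2) ^+ m); last first.
  by rewrite -exprMn mulrCA divff ?mulr1.
by rewrite [m`!%:R * _]mulrC -mulrA ler_wpM2l ?exprn_ge0// ler_exp_fact//; lra.
Qed.

Lemma bernoulli_ineq (x : R) n : 0 <= x <= 1 -> 1 - n%:R * x <= (1 - x) ^+ n.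
Proof.
move=> /andP[x0 x1]; elim: n => [|n IH]; first by rewrite mul0r subr0 expr0.
rewrite exprS; apply: (@le_trans _ _ ((1 - x) * (1 - n%:R * x))).
  rewrite -natr1; have : 0 <= n%:R * (x * x) by rewrite !mulr_ge0.
  by lra.
by rewrite ler_wpM2l//; lra.
Qed.

Lemma exp_approx_le (r : R) n : 0 < r < n.+1%:R ->
  (1 - r / n.+1%:R) ^+ n <= expR (- r) * expR (r / n.+1%:R).
Proof.
move=> /andP[r0 rn]; have n0 : 0 < n.+1%:R :> R by [].
set q := r / _; have q0 : 0 < q by rewrite divr_gt0.
have q1 : q < 1 by rewrite ltr_pdivrMr ?mul1r.
have -> : expR (- r) * expR q = expR (- q) ^+ n.
  rewrite -expRD -expRM_natl; congr expR.
  have : n.+1%:R * q = r by rewrite /q mulrC divfK// gt_eqF.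
  by rewrite -natr1; lra.
rewrite lerXn2r ?nnegrE ?expR_ge0//; first lra.
by have := expR_ge1Dx (- q).
Qed.

(** From exp q (1 - q) >= 1 - q^2 and Bernoulli's inequality. *)
Lemma exp_approx_ge (r : R) n : 0 < r < n.+1%:R ->
  expR (- r) * (1 - r * (r / n.+1%:R)) <= (1 - r / n.+1%:R) ^+ n.
Proof.
move=> /andP[r0 rn]; have n0 : 0 < n.+1%:R :> R by [].
set q := r / _; have q0 : 0 < q by rewrite divr_gt0.
have q1 : q < 1 by rewrite ltr_pdivrMr ?mul1r.
have rq : n.+1%:R * q = r by rewrite /q mulrC divfK// gt_eqF.
have qq : q * q <= 1.
  by have := ltW q1; have := ltW q0; exact: (fun a b => mulr_ile1 a a b b).
apply: (@le_trans _ _ ((expR (- q) * (1 - q * q)) ^+ n)); last first.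
  rewrite lerXn2r ?nnegrE//; [|lra|].
    by rewrite mulr_ge0 ?expR_ge0// subr_ge0.
  rewrite (_ : 1 - q * q = (1 + q) * (1 - q)); last by ring.
  rewrite mulrA -[leRHS]mul1r ler_wpM2r//; first lra.
  rewrite -[leRHS](expRxMexpNx_1 q) mulrC ler_wpM2r ?expR_ge0//.
  exact: expR_ge1Dx.
rewrite exprMn -expRM_natl.
apply: (@le_trans _ _ (expR (- r) * (1 - q * q) ^+ n)); last first.
  rewrite ler_wpM2r ?exprn_ge0 ?subr_ge0//.
  by rewrite ler_expR; move: rq; rewrite -natr1; lra.
rewrite ler_wpM2l ?expR_ge0//.
apply: le_trans (bernoulli_ineq n _); last first.
  by rewrite qq mulr_ge0 ?ltW.
have q0' := ltW q0.
rewrite lerD2l lerN2 mulrA ler_wpM2r//.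
by rewrite -rq ler_wpM2r// ler_nat.
Qed.

Lemma cvg_inv_natS (c : R) : (fun n => c / n.+1%:R) @ \oo --> 0.
Proof.
rewrite -[X in _ --> X](mulr0 c); apply: cvgMr; exact: cvg_harmonic.
Qed.

Lemma cvg_exp_approx (r : R) : 0 < r ->
  (fun n => (1 - r / n.+1%:R) ^+ n) @ \oo --> expR (- r).
Proof.
move=> r0.
have h (c : R) := cvg_inv_natS c.
apply: (@squeeze_cvgr _ _ _ _ (fun n => expR (- r) * (1 - r * (r / n.+1%:R)))
  (fun n => expR (- r) * expR (r / n.+1%:R))).
- near=> n.
  have rn : 0 < r < n.+1%:R.
    rewrite r0/= (lt_le_trans (truncnS_gt r))// ler_nat ltnS.
    by near: n; exact: nbhs_infty_ge.
  by rewrite exp_approx_le ?exp_approx_ge.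
- rewrite -[X in _ --> X]mulr1; apply: cvgMr.
  rewrite -[X in _ --> X](subr0 1) -[X in _ --> _ - X](mulr0 r).
  by apply: cvgB; [exact: cvg_cst|apply: cvgMr; exact: h].
- rewrite -[X in _ --> X]mulr1; apply: cvgMr.
  rewrite -[X in _ --> X](@expR0 R).
  exact: (cvg_comp _ _ (h r) (@continuous_expR R 0)).
Unshelve. all: by end_near. Qed.


(** The left-hand side is the beta integral over ]0, n + 1[, in which
    (1 - r / (n + 1))^n tends to exp (- r) below e exp (- r). *)
Lemma gauss_limit_integral (x : R) : 0 < x ->
  (fun n => (n.+1%:R `^ (x - 1) / rising_coef x n.+1)) @ \oo -->
  (euler_integral x : R).
Proof.
move=> x0.
pose fn n r := (r `^ (x - 1) * (1 - r / n.+1%:R) ^+ n : R).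
have mI : measurable (`]0, +oo[%classic : set (measurableTypeR R)) by [].
have mJ (n : nat) : measurable (`]0, n.+1%:R[%classic : set (measurableTypeR R)) by [].
have n0 n : 0 < n.+1%:R :> R by [].
have [||r|||_] := @real_dominated_convergence _ (measurableTypeR R) R mu
  `]0, +oo[%classic (fun n => fn n \_ `]0, n.+1%:R[%classic)
  (fun r => r `^ (x - 1) * expR (- r))
  (fun r => expR 1 * (r `^ (x - 1) * expR (- r)) + 0 * (r `^ (x - 1) * expR (- r))).
- exact: mI.
- move=> n; apply: measurable_funTS; apply: ((measurable_restrictT (fn n) (mJ n)).1 _).
  apply: measurable_funM; first by apply: measurable_funTS; exact: measurable_powR.
  by apply: measurable_funX; apply: measurable_funB => //; apply: measurable_funM.
- rewrite /= in_itv/= andbT => r0.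
  have h : (fun n => fn n r) @ \oo --> r `^ (x - 1) * expR (- r).
    by apply: cvgMr; exact: cvg_exp_approx.
  apply: cvg_trans h; apply: near_eq_cvg; near=> n.
  rewrite patchE mem_set//= in_itv/= r0/= (lt_le_trans (truncnS_gt r))//.
  by rewrite ler_nat ltnS; near: n; exact: nbhs_infty_ge.
- by apply: integrable_linear => //; exact: integrable_euler.
- move=> n r; rewrite /= in_itv/= andbT => r0.
  rewrite mul0r addr0 patchE; case: ifPn => [|_]; last first.
    by rewrite normr0 !mulr_ge0// ?expR_ge0 ?powR_ge0.
  rewrite inE/= in_itv/= => /andP[_ rn].
  have q1 : r / n.+1%:R < 1 by rewrite ltr_pdivrMr ?mul1r.
  rewrite ger0_norm; last first.
    by rewrite mulr_ge0 ?powR_ge0// exprn_ge0// subr_ge0 ltW.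
  rewrite mulrCA ler_wpM2l ?powR_ge0//.
  rewrite (le_trans (exp_approx_le _)) ?r0// mulrC ler_wpM2r ?expR_ge0//.
  by rewrite ler_expR ltW.
rewrite /euler_integral.
apply: cvg_trans; apply: near_eq_cvg; apply: nearW => n.
rewrite -Rintegral_mkcondr.
have -> : `]0, +oo[ `&` `]0, n.+1%:R[ = `]0, n.+1%:R[%classic :> set R.
  apply/seteqP; split => [r []//|r]; rewrite /= !in_itv/= andbT.
  by move=> /andP[-> ->].
rewrite (beta_integral n x0 (n0 n)).2 powRB; last by rewrite (gt_eqF (n0 n)) implybT.
by rewrite powRr1// invfM mulrA.
Unshelve. all: by end_near. Qed.

Lemma euler_integral_gt0 (x : R) : 0 < x -> 0 < euler_integral x.
Proof.
move=> x0; rewrite /euler_integral.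
have mI : measurable (`]0, +oo[%classic : set (measurableTypeR R)) by [].
have m1 : measurable (`]0, 1[%classic : set (measurableTypeR R)) by [].
have [i1 I1] := beta_integral 1 x0 (@ltr01 R).
pose f r : R := r `^ (x - 1) * (1 - r / 1) ^+ 1.
have e : `]0, +oo[ `&` `]0, 1[ = `]0, 1[%classic :> set R.
  apply/seteqP; split => [r []//|r]; rewrite /= !in_itv/= andbT.
  by move=> /andP[-> ->].
apply: (@lt_le_trans _ _ (\int[mu]_(r in `]0, +oo[) (f \_ `]0, 1[) r)%R).
  rewrite -Rintegral_mkcondr e I1 powR1 divr_gt0// mulr_gt0//.
  exact: rising_coef_gt0.
apply: le_Rintegral => //.
- apply: (@integrableS _ _ _ _ setT) => //.
  by rewrite -restrict_EFin; apply/(integrable_mkcond _ m1).1.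
- exact: integrable_euler.
- move=> r _; rewrite patchE; case: ifPn => [_|_]; last first.
    by rewrite mulr_ge0 ?powR_ge0 ?expR_ge0.
  by rewrite ler_wpM2l ?powR_ge0// expr1 divr1; exact: expR_ge1Dx.
Qed.

Lemma cvg_powR1 (u : nat -> R) (a l : R) : 0 < l -> u @ \oo --> l ->
  (fun n => u n `^ a) @ \oo --> l `^ a.
Proof. by move=> l0 ul; exact: (cvg_comp _ _ ul (@continuous_powR R a _ l0)). Qed.

Lemma cvg_ratioS (y : R) : (fun n => (y + n%:R) / n.+1%:R) @ \oo --> (1 : R).
Proof.
rewrite (_ : (fun _ => _) = (fun n => 1 + (y - 1) / n.+1%:R)); last first.
  apply/funext => n; have n0 : n.+1%:R != 0 :> R by rewrite pnatr_eq0.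
  by rewrite -natr1 in n0 *; field.
rewrite -[X in _ --> X]addr0; apply: cvgD; first exact: cvg_cst.
exact: cvg_inv_natS.
Qed.

Lemma gauss_limit_gt0 (x : R) : 0 < x ->
  (fun n => (n.+1%:R `^ (1 - x) * rising_coef x n)) @ \oo --> (euler_integral x)^-1.
Proof.
move=> x0.
have h : (fun n => (n.+1%:R `^ (x - 1) / rising_coef x n.+1)^-1) @ \oo -->
    (euler_integral x : R)^-1.
  apply: cvgV; last exact: gauss_limit_integral.
  by rewrite gt_eqF// euler_integral_gt0.
have g : (fun n => ((x + n%:R) / n.+1%:R)^-1) @ \oo --> (1 : R)^-1.
  by apply: cvgV; [exact: oner_neq0|exact: cvg_ratioS].
have -> : (euler_integral x)^-1 = (euler_integral x)^-1 * 1^-1 :> R.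
  by rewrite invr1 mulr1.
apply: cvg_trans (cvgM h g); apply: near_eq_cvg; near=> n.
have n0 : n.+1%:R != 0 :> R by rewrite pnatr_eq0.
have xn : x + n%:R != 0 by rewrite gt_eqF// ltr_wpDr.
have -> : rising_coef x n = n.+1%:R * rising_coef x n.+1 / (x + n%:R).
  by rewrite rising_coefS mulrAC divff// mul1r.
rewrite -(opprB x) powRN.
have p0 : n.+1%:R `^ (x - 1) != 0 :> R by rewrite powR_eq0 negb_and n0.
rewrite /=; field.
by rewrite xn p0 addrC natr1 n0 gt_eqF ?rising_coef_gt0.
Unshelve. all: by end_near. Qed.

(** The step that extends the limit to y <= 0; the factor y is the one by which
    Gamma is continued to the left. *)
Lemma gauss_limit_pred (y l : R) :
  (fun n => (n.+1%:R `^ (1 - (y + 1)) * rising_coef (y + 1) n)) @ \oo --> l ->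
  (fun n => (n.+1%:R `^ (1 - y) * rising_coef y n)) @ \oo --> y * l.
Proof.
move=> h; rewrite -cvg_shiftS/=.
have g : (fun n => ((2 + n%:R) / n.+1%:R) `^ (1 - y)) @ \oo --> (1 : R).
  have := @cvg_powR1 (fun n => (2 + n%:R) / n.+1%:R) (1 - y) 1 ltr01 (cvg_ratioS 2).
  by rewrite powR1.
have -> : y * l = y * l * 1 by rewrite mulr1.
have yh : (fun n => y * (n.+1%:R `^ (1 - (y + 1)) * rising_coef (y + 1) n)) @ \oo
    --> y * l by apply: cvgMr.
apply: cvg_trans (cvgM yh g).
apply: near_eq_cvg; near=> n.
have n0 : 0 < n.+1%:R :> R by [].
have -> : rising_coef y n.+1 = y * rising_coef (y + 1) n / n.+1%:R.
  by rewrite -rising_coef_shift mulrAC divff ?mul1r// gt_eqF.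
have -> : 1 - (y + 1) = (1 - y) - 1 by ring.
rewrite /= (@powRB _ n.+1%:R (1 - y) 1); last by rewrite (gt_eqF n0) implybT.
rewrite powRr1 ?ltW// powRM ?invr_ge0 ?addr_ge0//.
have -> : 2 + n%:R = n.+2%:R :> R by rewrite -natrD add2n.
have -> : n.+1%:R^-1 `^ (1 - y) = (n.+1%:R `^ (1 - y))^-1 :> R.
  by rewrite -powR_inv1 ?ltW// -powRrM mulN1r powRN.
by field; rewrite addrC natr1 gt_eqF//= powR_eq0 negb_and gt_eqF.
Unshelve. all: by end_near. Qed.

End gauss_limit.

(** * Asymptotics of the coefficients of (1 - X)^(-y) *)

Section rising_coef_asymptotics.
Context {R : realType}.

Lemma gauss_limit (y : R) :
  (fun n => (n.+1%:R `^ (1 - y) * rising_coef y n)) @ \oo --> (Gamma y)^-1.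
Proof.
rewrite /Gamma; case: ifPn => [y0|]; first exact: gauss_limit_gt0.
rewrite -leNgt => y0.
set n := (Num.truncn (- y)).+1.
have yn : 0 < y + n%:R.
  by have := truncnS_gt (- y); rewrite -/n; lra.
rewrite invf_div; move: n yn => n.
elim: n y {y0} => [|n IH] y yn.
  by rewrite addr0 big_ord0 mul1r; apply: gauss_limit_gt0; rewrite addr0 in yn.
rewrite big_ord_recl/= addr0 -mulrA; apply: gauss_limit_pred.
have e : y + n.+1%:R = y + 1 + n%:R by rewrite -natr1; ring.
have := IH (y + 1); rewrite -e => /(_ yn).
rewrite (eq_bigr (fun k : 'I_n => y + (bump 0 k)%:R))// => k _.
by rewrite /bump/= add1n -natr1; ring.
Qed.

Lemma rising_coef_le (y : R) :
  exists2 C, 0 <= C & forall k, `|rising_coef y k| <= C * k.+1%:R `^ (y - 1).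
Proof.
have /cvg_seq_bounded [M [_ HM]] : cvgn (fun n => n.+1%:R `^ (1 - y) * rising_coef y n).
  by apply/cvg_ex; eexists; exact: gauss_limit.
have {}HM k := HM (`|M| + 1) (ltr_pwDr ltr01 (ler_norm M)) k Logic.I.
exists (`|M| + 1) => [|k]; first by rewrite addr_ge0.
have k0 : 0 < k.+1%:R :> R by [].
rewrite -(opprB 1 y) powRN ler_pdivlMr ?powR_gt0// mulrC.
by have := HM k; rewrite /= normrM [X in X * _ <= _ -> _]ger0_norm ?powR_ge0.
Qed.

Lemma rising_coef_ge (y : R) : 0 < y ->
  exists2 c, 0 < c & forall k, c * k.+1%:R `^ (y - 1) <= rising_coef y k.
Proof.
move=> y0.
have cv : (fun n => (n.+1%:R `^ (1 - y) * rising_coef y n)^-1) @ \oo -->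
    ((Gamma y)^-1)^-1.
  apply: cvgV; last exact: gauss_limit.
  by rewrite /Gamma y0 invr_eq0 gt_eqF// euler_integral_gt0.
have /cvg_seq_bounded [M [_ HM]] : cvgn (fun n => (n.+1%:R `^ (1 - y) * rising_coef y n)^-1).
  by apply/cvg_ex; eexists; exact: cv.
have {}HM k := HM (`|M| + 1) (ltr_pwDr ltr01 (ler_norm M)) k Logic.I.
have M0 : 0 < `|M| + 1 by rewrite ltr_wpDl.
exists (`|M| + 1)^-1 => [|k]; first by rewrite invr_gt0.
have k0 : 0 < k.+1%:R :> R by [].
have r0 := rising_coef_gt0 k y0.
rewrite -(opprB 1 y) powRN -invfM -[leRHS]invrK.
have X0 : 0 < (`|M| + 1) * k.+1%:R `^ (1 - y) by rewrite mulr_gt0// powR_gt0.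
rewrite lef_pV2 ?posrE ?invr_gt0//.
rewrite -ler_pdivrMr ?powR_gt0//.
have := HM k; rewrite /= ger0_norm; last by rewrite invr_ge0 mulr_ge0 ?powR_ge0 ?ltW.
by rewrite invfM mulrC.
Qed.

(** With a = 1 - y, the left-hand side is nonincreasing in k once k + 1 >= a, as
    (1 + d)^a (1 - a d) <= 1, and for k <= a the factors |y + j| of
    rising_coef y k are at most a. That the bound is uniform in k and explicit
    in y is needed to sum over y = b - alpha m. *)
Lemma rising_coef_unif (y : R) k : y <= 0 ->
  k.+1%:R `^ (1 - y) * `|rising_coef y k| <= (2 - y) `^ (1 - y) * expR (1 - y).
Proof.
move=> y0; set a := 1 - y.
have a1 : 1 <= a by rewrite /a; lra.
have small j : j%:R <= a -> `|rising_coef y j| <= expR a.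
  move=> ja.
  have : `|rising_coef y j| <= a ^+ j / j`!%:R.
    elim: j ja => [|j IH] ja.
      by rewrite rising_coef0 normr1 expr0 fact0 divr1.
    have ja' : j%:R <= a by move: ja; rewrite -natr1; lra.
    have j0 : 0 <= j%:R :> R by [].
    rewrite -(@ler_pM2l _ j.+1%:R) ?ltr0n//.
    rewrite -[X in X * `|_|]ger0_norm ?ler0n// -normrM rising_coefS normrM.
    have -> : j.+1%:R * (a ^+ j.+1 / j.+1`!%:R) = a * (a ^+ j / j`!%:R).
      have f0 : j`!%:R != 0 :> R by rewrite pnatr_eq0 -lt0n fact_gt0.
      by rewrite factS natrM exprS; field; rewrite f0 addrC natr1 pnatr_eq0.
    apply: ler_pM => //; last exact: IH.
    by rewrite ler_norml; apply/andP; split; rewrite /a in ja' *; lra.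
  move=> /le_trans -> //.
  by rewrite ler_pdivrMr ?ltr0n ?fact_gt0// mulrC ler_exp_fact//; lra.
elim: k => [|k IH].
  rewrite powR1 mul1r (le_trans (small 0 _))//; first lra.
  rewrite -[leLHS]mul1r ler_wpM2r ?expR_ge0//.
  by rewrite -[X in X <= _](@powRr0 _ (2 - y)) ler_powR//; lra.
have [ka|ka] := leP k.+1%:R a.
  apply: ler_pM; rewrite ?powR_ge0//; last exact: small.
  apply: ge0_ler_powR; rewrite ?nnegrE//; [lra..|].
  by move: ka; rewrite -[k.+2%:R]natr1 /a; lra.
apply: le_trans IH.
have k0 : 0 < k.+1%:R :> R by [].
rewrite -(@ler_pM2l _ k.+1%:R)//.
have -> : k.+1%:R * (k.+2%:R `^ a * `|rising_coef y k.+1|) =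
    k.+2%:R `^ a * `|k.+1%:R - a| * `|rising_coef y k|.
  rewrite mulrCA -[X in X * `|_|]ger0_norm ?ler0n// -normrM rising_coefS normrM.
  rewrite mulrA; congr (_ * `|_| * _); rewrite /a -natr1; ring.
rewrite mulrA ler_wpM2r//.
have d0 : 0 < k.+1%:R^-1 :> R by rewrite invr_gt0.
rewrite gtr0_norm ?subr_gt0//.
have -> : k.+2%:R = k.+1%:R * (1 + k.+1%:R^-1) :> R.
  by rewrite mulrDr mulr1 divff ?natr1// gt_eqF.
have p0 : 0 <= 1 + k.+1%:R^-1 :> R by rewrite addr_ge0// ltW.
rewrite powRM//.
have -> : k.+1%:R - a = k.+1%:R * (1 - a / k.+1%:R) by field; rewrite addrC natr1 gt_eqF.
rewrite mulrACA [k.+1%:R * _ in leRHS]mulrC -[leRHS]mulr1 ler_wpM2l//.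
apply: (@le_trans _ _ (expR (a / k.+1%:R) * expR (- (a / k.+1%:R)))).
  apply: ler_pM; rewrite ?powR_ge0//.
  - by rewrite subr_ge0 ler_pdivrMr ?mul1r ?ltW.
  - rewrite mulrC expRM; apply: ge0_ler_powR; rewrite ?nnegrE ?expR_ge0//; first lra.
    exact: expR_ge1Dx.
  - by have := expR_ge1Dx (- (a / k.+1%:R)).
by rewrite expRxMexpNx_1.
Qed.

Lemma rising_coef_scaled (y r : R) (k : nat -> nat) : 0 < r ->
  (fun n => (k n).+1%:R / n.+1%:R) @ \oo --> r ->
  (fun n => n.+1%:R `^ (1 - y) * rising_coef y (k n)) @ \oo -->
  r `^ (y - 1) / Gamma y.
Proof.
move=> r0 kr.
have kinf : k @ \oo --> \oo.
  apply/cvgnyPge => A.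
  have r2 : r / 2 < r by lra.
  near=> n.
  have h1 : r / 2 < (k n).+1%:R / n.+1%:R.
    by near: n; move/cvgr_gt : kr; exact.
  have h2 : (A.+1%:R / (r / 2)) <= n.+1%:R.
    rewrite (le_trans (ltW (truncnS_gt _)))// ler_nat ltnS.
    by near: n; exact: nbhs_infty_ge.
  rewrite ltr_pdivlMr// in h1; rewrite ler_pdivrMr ?divr_gt0// in h2.
  have : A.+1%:R < (k n).+1%:R :> R by rewrite (le_lt_trans h2)// mulrC.
  by rewrite ltr_nat ltnS => /ltnW.
have h := cvg_comp _ _ kinf (@gauss_limit y).
have g := @cvg_powR1 _ (fun n => (k n).+1%:R / n.+1%:R) (y - 1) r r0 kr.
apply: cvg_trans (cvgM g h); apply: near_eq_cvg; near=> n => /=.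
have k0 : 0 < (k n).+1%:R :> R by [].
have n0 : 0 < n.+1%:R :> R by [].
rewrite mulrA; congr (_ * _).
rewrite powRM ?invr_ge0//.
have -> : n.+1%:R^-1 `^ (y - 1) = n.+1%:R `^ (1 - y) :> R.
  by rewrite -powR_inv1 ?ltW// -powRrM mulN1r opprB.
rewrite -(opprB 1 y) powRN; field.
by rewrite powR_eq0 negb_and gt_eqF.
Unshelve. all: by end_near. Qed.

End rising_coef_asymptotics.

(** * Coefficients of (1 - X)^(-b) exp (- w (1 - X)^alpha) *)

Section stable_coef.
Context {R : realType}.
Variable alpha : R.
Hypothesis alpha01 : 0 < alpha < 1.
Implicit Types (b w y : R) (k : nat).

(** The coefficient of X^k in (1 - X)^(-b) exp (- w (1 - X)^alpha), through the
    expansion of the exponential. The derivative in w subtracts alpha from b, so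
    that b ranges over all reals. *)
Definition stable_coef b k w : R :=
  eser (fun m => rising_coef (b - alpha * m%:R) k) (- w).

Local Notation a := stable_coef.

Lemma geo_bounded_rising b k :
  geo_bounded (fun m => rising_coef (b - alpha * m%:R) k).
Proof.
move: alpha01 => /andP[a0 a1].
exists (k`!%:R * expR (`|b| + 1)), (expR alpha) => m.
rewrite (le_trans (rising_coef_bound _ _))// -mulrA ler_wpM2l//.
rewrite -expRM_natl -expRD ler_expR.
have h : `|b - alpha * m%:R| <= `|b| + `|alpha * m%:R| by exact: ler_normB.
have h2 : `|alpha * m%:R| = m%:R * alpha.
  by rewrite ger0_norm 1?mulrC// mulr_ge0// ltW.
by rewrite h2 in h; lra.
Qed.

Lemma stable_coef_at0 b k : a b k 0 = rising_coef b k.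
Proof. by rewrite /a oppr0 eser0 mulr0 subr0. Qed.

(** Multiplication by (1 - X)^(-y). *)
Lemma stable_coefD y b k w :
  a (y + b) k w = \sum_(j < k.+1) rising_coef y j * a b (k - j) w.
Proof.
rewrite /a -(@eser_sum _ _ _ _ (fun (j : 'I_k.+1) m => rising_coef (b - alpha * m%:R) (k - j))).
  by congr eser; apply/funext => m; rewrite -addrA rising_coefD.
by move=> j; exact: geo_bounded_rising.
Qed.

Lemma is_derive_stable_coef b k w : is_derive w 1 (a b k) (- a (b - alpha) k w).
Proof.
have h := eser_is_derive (- w) (geo_bounded_rising b k).
rewrite -mulrN1 (_ : a (b - alpha) k w =
    eser (fun m => rising_coef (b - alpha * m.+1%:R) k) (- w)); last first.
  congr eser; apply/funext => m; congr rising_coef.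
  by rewrite -natr1; ring.
have g : is_derive w 1 (fun v : R => - v) (- 1) by apply: is_deriveNid.
exact: (@is_derive1_comp _ _ (fun v : R => - v)).
Qed.

Lemma continuous_stable_coef b k : continuous (a b k).
Proof.
move=> w; apply: differentiable_continuous; apply/derivable1_diffP.
by have [] := is_derive_stable_coef b k w.
Qed.

(** The coefficientwise form of the logarithmic derivative in X of
    (1 - X)^(-b) exp (- w (1 - X)^alpha). *)
Lemma stable_coefS b k w : k.+1%:R * a b k.+1 w =
  b * a (b + 1) k w + alpha * w * a (b + 1 - alpha) k w.
Proof.
have g1 := geo_bounded_rising (b + 1) k.
have gM := geo_boundedM_nat g1.
rewrite /a -eserZ; last exact: geo_bounded_rising.
rewrite (_ : (fun m : nat => k.+1%:R * _) = (fun m =>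
    b * rising_coef (b + 1 - alpha * m%:R) k +
    (- alpha) * (m%:R * rising_coef (b + 1 - alpha * m%:R) k))); last first.
  apply/funext => m; rewrite rising_coef_shift.
  have -> : b - alpha * m%:R + 1 = b + 1 - alpha * m%:R by ring.
  by ring.
rewrite eserD; [|exact: geo_boundedZ|exact: geo_boundedZ].
rewrite !eserZ// eserM_nat//.
rewrite (_ : (fun m => rising_coef (b + 1 - alpha * m.+1%:R) k) =
  (fun m => rising_coef (b + 1 - alpha - alpha * m%:R) k)); last first.
  by apply/funext => m; congr rising_coef; rewrite -natr1; ring.
by ring.
Qed.

(** The hypothesis says that v |-> f v exp (c v) is nondecreasing. *)
Lemma gronwall_ge (f df : R -> R) (c w : R) : 0 <= w ->
  (forall v : R, is_derive v 1 f (df v)) ->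
  (forall v : R, 0 < v -> 0 <= df v + c * f v) ->
  f 0 * expR (- (c * w)) <= f w.
Proof.
move=> w0 fd fge.
pose g (v : R) : R := f v * expR (c * v).
have gd (v : R) : is_derive v 1 g ((df v + c * f v) * expR (c * v)).
  have e1 : is_derive v 1 (fun v : R => c * v) c.
    by rewrite -[X in is_derive _ _ _ X](mulr1 c); apply: (@is_deriveZ _ _ _ id).
  have e2 : is_derive v 1 (fun v : R => expR (c * v)) (expR (c * v) * c).
    exact: (@is_derive1_comp _ expR (fun v : R => c * v)).
  rewrite (_ : _ * _ = f v *: (expR (c * v) * c) + expR (c * v) *: df v).
    exact: (@is_deriveM _ _ f (fun v : R => expR (c * v))).
  by rewrite /GRing.scale/=; ring.
have gc v : {for v, continuous g}.
  by have [h _] := gd v; apply: differentiable_continuous; apply/derivable1_diffP.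
have : g 0 <= g w.
  apply: (@ger0_derive1_ndecry _ g 0) => //.
  - move=> x; rewrite in_itv/= andbT => x0; rewrite derive1E.
    by have [_ ->] := gd x; rewrite mulr_ge0 ?expR_ge0 ?fge.
  - by apply: continuous_subspaceT => x; exact: gc.
by rewrite /g mulr0 expR0 mulr1 -ler_pdivrMr ?expR_gt0// expRN.
Qed.

(** Except for its term of index 0, the convolution of stable_coefD with
    (1 - X)^alpha has nonpositive weights: by induction on k, the derivative plus
    the function itself is nonnegative. *)
Lemma stable_coef_ge0 b k w : 0 <= b -> 0 <= w -> 0 <= a b k w.
Proof.
move=> b0; elim/ltn_ind: k w => k IH w w0.
have := @gronwall_ge (a b k) (fun v => - a (b - alpha) k v) 1 w w0 _ _.
rewrite stable_coef_at0 => h; apply: le_trans (h _ _).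
- by rewrite mulr_ge0 ?rising_coef_ge0 ?expR_ge0.
- by move=> v; exact: is_derive_stable_coef.
move=> v v0; rewrite mul1r [b - alpha]addrC stable_coefD big_ord_recl/=.
rewrite rising_coef0 mul1r subn0 opprD addrAC addNr add0r.
rewrite oppr_ge0 sumr_le0// => j _; rewrite /bump/= add1n.
rewrite mulr_le0_ge0//.
  by rewrite rising_coefN_le0//; move: alpha01 => /andP[/ltW -> /ltW ->].
by apply: IH; [rewrite ltn_subrL/= (leq_ltn_trans _ (ltn_ord j))|exact: ltW].
Qed.

(** The coefficient is the sum of the first k + 1 coefficients for b - 1, a mass
    that decreases at least at the rate rising_coef (1 - alpha) k of the jumps
    longer than k. *)
Lemma stable_coef_le_exp b k w : 1 <= b -> 0 <= w ->
  a b k w <= rising_coef b k * expR (- (rising_coef (1 - alpha) k * w)).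
Proof.
move=> b1 w0; move: (alpha01) => /andP[a0 a1].
have := @gronwall_ge (fun v => - a b k v) (fun v => a (b - alpha) k v)
  (rising_coef (1 - alpha) k) w w0.
rewrite stable_coef_at0 mulNr lerN2; apply.
  move=> v; rewrite -[X in is_derive _ _ _ X]opprK; apply: is_deriveN.
  exact: is_derive_stable_coef.
move=> v v0; rewrite mulrN subr_ge0.
have -> : b - alpha = (1 - alpha) + (b - 1) by ring.
have {1}-> : b = 1 + (b - 1) by ring.
rewrite !stable_coefD mulr_sumr ler_sum// => j _.
rewrite rising_coef_1 mul1r ler_wpM2r//.
  by apply: stable_coef_ge0; [rewrite subr_ge0|exact: ltW].
by apply: rising_coef_nonincr; [lra|rewrite -ltnS].
Qed.



Lemma powR_pred_le (p : R) k : -1 <= p -> k.+1%:R `^ p <= 2 * k.+2%:R `^ p.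
Proof.
move=> p1.
have k1 : 0 < k.+1%:R :> R by [].
have k2 : 0 < k.+2%:R :> R by [].
have P2 := powR_gt0 p k2.
have [p0|p0] := leP 0 p.
  apply: (@le_trans _ _ (k.+2%:R `^ p)); last by lra.
  by apply: ge0_ler_powR; rewrite ?nnegrE// ler_nat.
have inv (x : R) : x `^ p = (x `^ (- p))^-1 by rewrite powRN invrK.
rewrite !inv ler_pdivlMr ?powR_gt0// mulrC ler_pdivrMr ?powR_gt0//.
rewrite -{1}(@powRr1 _ 2)//.
apply: (@le_trans _ _ ((2 * k.+1%:R) `^ (- p))).
  apply: ge0_ler_powR; rewrite ?nnegrE ?oppr_ge0 ?(ltW p0)// -natrM ler_nat.
  by rewrite mul2n -addnn addSnnS ltn_addl.
rewrite powRM// ler_wpM2r ?powR_ge0// ler_powR//; lra.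
Qed.

Lemma powR_le_expR (p : R) : 0 <= p ->
  exists2 K, 0 < K & forall x : R, 0 <= x -> x `^ p <= K * expR x.
Proof.
move=> p0.
pose n := (Num.truncn p).+1.
exists (1 + n`!%:R) => [|x x0]; first by rewrite ltr_pwDl.
rewrite mulrDl mul1r.
have E1 : 1 <= expR x by rewrite -expR0 ler_expR.
have F0 : 0 <= n`!%:R * expR x by rewrite mulr_ge0 ?expR_ge0.
have [x1|x1] := leP x 1.
  apply: (@le_trans _ _ 1); last by lra.
  have e1 : 1 = 1 `^ p :> R by rewrite powR1.
  by rewrite [leRHS]e1; apply: ge0_ler_powR; rewrite ?nnegrE.
apply: (@le_trans _ _ (x ^+ n)).
  rewrite -powR_mulrn//; apply: ler_powR; first exact: ltW.
  exact/ltW/truncnS_gt.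
by rewrite (le_trans (ler_exp_fact _ x0))// lerDr expR_ge0.
Qed.

Lemma stable_coef_le_ge1 b theta : 1 <= b -> 0 <= theta ->
  exists2 C, 0 <= C & forall k w, 0 <= w ->
    a b k w * w `^ theta <= C * k.+1%:R `^ (b - 1 + alpha * theta).
Proof.
move=> b1 t0; move: (alpha01) => /andP[a0 a1].
have [C C0 HC] := rising_coef_le b.
have [c c0 Hc] := @rising_coef_ge _ (1 - alpha) ltac:(lra).
have [K K0 HK] := powR_le_expR t0.
exists (C * K * c `^ (- theta)) => [|k w w0].
  by rewrite !mulr_ge0 ?powR_ge0 ?(ltW K0).
have k0 : 0 < k.+1%:R :> R by [].
set ck := rising_coef (1 - alpha) k.
have ck0 : 0 < ck by apply: rising_coef_gt0; lra.
apply: (@le_trans _ _ (C * k.+1%:R `^ (b - 1) * expR (- (ck * w)) * w `^ theta)).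
  rewrite ler_wpM2r ?powR_ge0// (le_trans (stable_coef_le_exp _ _ _))//.
  by rewrite ler_wpM2r ?expR_ge0// (le_trans (ler_norm _)).
rewrite (@powRD _ _ (b - 1)); last by rewrite (gt_eqF k0) implybT.
rewrite [leRHS](_ : _ = C * k.+1%:R `^ (b - 1) *
    (K * (c `^ (- theta) * k.+1%:R `^ (alpha * theta)))); last by ring.
rewrite -mulrA ler_wpM2l ?mulr_ge0 ?powR_ge0//.
have -> : w `^ theta = (ck * w) `^ theta * ck `^ (- theta).
  rewrite powRM// ?(ltW ck0)// powRN; field.
  by rewrite powR_eq0 negb_and gt_eqF.
rewrite mulrA ler_pM ?powR_ge0 ?mulr_ge0 ?expR_ge0 ?powR_ge0//.
  rewrite expRN mulrC ler_pdivrMr ?expR_gt0//.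
  by apply: HK; rewrite mulr_ge0// ltW.
rewrite [alpha * theta]mulrC.
have -> : k.+1%:R `^ (theta * alpha) = (k.+1%:R `^ (- alpha)) `^ (- theta) :> R.
  by rewrite -powRrM mulrNN mulrC.
rewrite -powRM ?powR_ge0 ?(ltW c0)// !powRN.
have P1 : 0 < ck `^ theta by rewrite powR_gt0.
have P2 : 0 < (c * (k.+1%:R `^ alpha)^-1) `^ theta.
  by rewrite powR_gt0// mulr_gt0// invr_gt0 powR_gt0.
rewrite lef_pV2 ?posrE//.
apply: ge0_ler_powR; rewrite ?nnegrE ?(ltW ck0)//.
  by rewrite mulr_ge0 ?invr_ge0 ?powR_ge0 ?(ltW c0).
by have := Hc k; rewrite addrAC subrr add0r powRN.
Qed.

(** The scaling bound behind all dominations. By stable_coefS the bound for b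
    follows from those for b + 1 and b + 1 - alpha, the latter with theta + 1;
    finitely many such steps lead from any b >= 0 to the case b >= 1. *)
Lemma stable_coef_le b theta : 0 <= b -> 0 <= theta ->
  exists2 C, 0 <= C & forall k w, 0 <= w ->
    a b k w * w `^ theta <= C * k.+1%:R `^ (b - 1 + alpha * theta).
Proof.
move=> b0 t0; move: (alpha01) => /andP[a0 a1].
have [n bn] : exists n : nat, 1 <= b + n%:R * (1 - alpha).
  exists (Num.truncn (1 / (1 - alpha))).+1.
  have : 1 / (1 - alpha) <= (Num.truncn (1 / (1 - alpha))).+1%:R.
    exact/ltW/truncnS_gt.
  by rewrite ler_pdivrMr; lra.
elim: n b theta b0 t0 bn => [|n IH] b theta b0 t0 bn.
  by apply: stable_coef_le_ge1 => //; lra.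
have [C1 C10 H1] := @stable_coef_le_ge1 (b + 1) theta ltac:(lra) t0.
have bn' : 1 <= b + 1 - alpha + n%:R * (1 - alpha) by rewrite -natr1 in bn; lra.
have [C2 C20 H2] := IH (b + 1 - alpha) (theta + 1) ltac:(lra) ltac:(lra) bn'.
have C0 : 0 <= 2 * (b * C1 + alpha * C2).
  by rewrite mulr_ge0// addr_ge0// mulr_ge0// ltW.
exists (C1 + 2 * (b * C1 + alpha * C2)) => [|[|k] w w0]; first exact: addr_ge0.
  have -> : a b 0 w = a (b + 1) 0 w.
    by congr eser; apply/funext => m; rewrite !rising_coef0.
  by rewrite (le_trans (H1 _ _ w0))// !powR1 !mulr1 lerDl.
have k1 : 0 < k.+1%:R :> R by [].
set e := b - 1 + alpha * theta.
have e1 : -1 <= e by rewrite /e; have := mulr_ge0 (ltW a0) t0; lra.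
apply: (@le_trans _ _ ((b * C1 + alpha * C2) * k.+1%:R `^ e)); last first.
  rewrite [leRHS]mulrDl -[leLHS]add0r lerD ?mulr_ge0 ?powR_ge0//.
  rewrite [2 * _]mulrC -mulrA ler_wpM2l ?powR_pred_le//.
  by rewrite pmulr_rge0 in C0.
rewrite -(@ler_pM2l _ k.+1%:R)// mulrA stable_coefS mulrDl.
rewrite [leRHS](_ : _ = (b * C1 + alpha * C2) * k.+1%:R `^ (e + 1)); last first.
  rewrite (@powRD _ _ e); last by rewrite (gt_eqF k1) implybT.
  by rewrite powRr1 ?(ltW k1)//; ring.
rewrite mulrDl lerD//.
  rewrite -!mulrA ler_wpM2l// (le_trans (H1 _ _ w0))//.
  by rewrite (_ : b + 1 - 1 + alpha * theta = e + 1)// /e; ring.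
rewrite -!mulrA ler_wpM2l ?(ltW a0)//.
have := H2 k w w0; rewrite (_ : b + 1 - alpha - 1 + alpha * (theta + 1) = e + 1); last first.
  by rewrite /e; ring.
apply: le_trans.
have -> : w `^ (theta + 1) = w * w `^ theta.
  by rewrite -{2}(addrK 1 theta) mulr_powRB1//; lra.
by rewrite mulrCA mulrA.
Qed.

End stable_coef.

(** * Convergence to the Wright function *)

Section tannery.
Context {R : realType}.
Implicit Types (u : nat -> R) (C : R).

Lemma geometric_tail u C m0 : 0 <= C ->
  (forall m, (m0 <= m)%N -> `|u m| <= C / 2 ^+ m) ->
  cvgn (series u) /\
  forall M, (m0 <= M)%N -> `|limn (series u) - series u M| <= 2 * C / 2 ^+ M.
Proof.
move=> C0 uC.
have D0 m : 0 < 2 ^+ m :> R by rewrite exprn_gt0.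
have cu : cvgn (series u).
  (* the terms before m0 are absorbed into the constant *)
  pose C' := C + \sum_(i < m0) `|u i| * 2 ^+ i.
  have S0 : 0 <= \sum_(i < m0) `|u i| * 2 ^+ i.
    by apply: sumr_ge0 => i _; rewrite mulr_ge0// ltW.
  apply: normed_cvg; apply: (@series_le_cvg _ _ (geometric C' (2^-1))).
  - by move=> m /=.
  - by move=> m /=; rewrite mulr_ge0 ?addr_ge0// exprn_ge0// invr_ge0.
  - move=> m; rewrite /= exprVn.
    have [mm|mm] := leqP m0 m.
      by rewrite (le_trans (uC m mm))// ler_wpM2r ?invr_ge0 ?(ltW (D0 m))// lerDl.
    rewrite ler_pdivlMr// /C' (bigD1 (Ordinal mm))//= addrCA lerDl addr_ge0//.
    by apply: sumr_ge0 => i _; rewrite mulr_ge0// ltW.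
  - by apply: is_cvg_geometric_series; rewrite ger0_norm ?invr_ge0// invf_lt1// ltr1n.
split=> // M mM.
have part p : `|series u (p + M)%N - series u M| <= 2 * C / 2 ^+ M - 2 * C / 2 ^+ (p + M).
  elim: p => [|p IH]; first by rewrite add0n !subrr normr0.
  rewrite addSn seriesSr addrAC (le_trans (ler_normD _ _))//.
  rewrite (le_trans (lerD IH (uC _ _)))//; first by rewrite (leq_trans mM)// leq_addl.
  rewrite exprS -addrA lerD2l le_eqVlt; apply/orP; left; apply/eqP.
  by field; rewrite gt_eqF.
have cvM : (fun p => `|series u (p + M)%N - series u M|) @ \oo -->
    `|limn (series u) - series u M|.
  apply: cvg_norm; apply: cvgB; last exact: cvg_cst.
  by rewrite (cvg_shiftn M (series u)).
apply: (ler_cvg_to cvM (cvg_cst (2 * C / 2 ^+ M))); apply: nearW => p.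
by rewrite (le_trans (part p))// lerBlDr lerDl divr_ge0 ?mulr_ge0// ltW.
Qed.

(** Tannery's theorem (dominated convergence for series), with domination
    required of the far terms only. *)
Lemma tannery (u : nat -> nat -> R) (l : nat -> R) C m0 : 0 <= C ->
  (forall m, (fun n => u n m) @ \oo --> l m) ->
  (\forall n \near \oo, forall m, (m0 <= m)%N -> `|u n m| <= C / 2 ^+ m) ->
  cvgn (series l) /\ (fun n => limn (series (u n))) @ \oo --> limn (series l).
Proof.
move=> C0 ul uC.
have lC m : (m0 <= m)%N -> `|l m| <= C / 2 ^+ m.
  move=> mm; apply: (ler_cvg_to (cvg_norm (ul m)) (cvg_cst (C / 2 ^+ m))).
  by near=> n; move: m mm; near: n.
have [cl Hl] := geometric_tail C0 lC.
split=> //; apply/cvgrPdist_le => e e0.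
have [M mM Me] : exists2 M, (m0 <= M)%N & 2 * C / 2 ^+ M <= e / 3.
  (* 2 C / 2^M <= 2 C / M, at most e / 3 as soon as M >= 6 C / e *)
  pose M := maxn m0 (Num.truncn (6 * C / e)).+1.
  exists M; first exact: leq_maxl.
  have h1 : 6 * C / e <= M%:R.
    rewrite (le_trans (ltW (truncnS_gt _)))// ler_nat; exact: leq_maxr.
  have h2 : M%:R <= 2 ^+ M :> R by rewrite -natrX ler_nat ltnW// ltn_expl.
  rewrite ler_pdivrMr ?exprn_gt0//.
  rewrite ler_pdivrMr// in h1.
  have h3 : M%:R * e <= 2 ^+ M * e by rewrite ler_wpM2r// ltW.
  by lra.
have cs : (fun n => series (u n) M) @ \oo --> series l M.
  elim: (M) => [|K IH].
    rewrite /series/= big_nil; under eq_fun do rewrite big_nil.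
    exact: cvg_cst.
  rewrite seriesSr; under eq_fun do rewrite seriesSr.
  by apply: cvgD => //; exact: ul.
near=> n.
have [cu Hu] : cvgn (series (u n)) /\
    forall M, (m0 <= M)%N -> `|limn (series (u n)) - series (u n) M| <= 2 * C / 2 ^+ M.
  by apply: geometric_tail => //; near: n.
have d1 := le_trans (Hl M mM) Me.
have d2 := le_trans (Hu M mM) Me.
have d3 : `|series l M - series (u n) M| <= e / 3.
  by near: n; move/cvgrPdist_le : cs; apply; rewrite divr_gt0.
have -> : limn (series l) - limn (series (u n)) =
  (limn (series l) - series l M) + (series l M - series (u n) M)
  - (limn (series (u n)) - series (u n) M) by ring.
have := ler_normB ((limn (series l) - series l M) + (series l M - series (u n) M))
   (limn (series (u n)) - series (u n) M).
have := ler_normD (limn (series l) - series l M) (series l M - series (u n) M).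
by lra.
Unshelve. all: by end_near. Qed.

(** Since alpha < 1, m^(alpha m) / m! decreases faster than any geometric
    sequence; this is the reason why the Wright series converges. *)
Lemma super_geometric (alpha X : R) : 0 < alpha < 1 -> 0 <= X ->
  exists m0, forall m, (m0 <= m)%N ->
    X ^+ m * m.+2%:R `^ (alpha * m%:R + 1) / m`!%:R <= 3 / 2 ^+ m.
Proof.
move=> /andP[a0 a1] X0.
(* With m! >= (m / e)^m, m + 2 <= 3 m and m <= 2^m it suffices to have
   (12 X e)^m <= m^((1 - alpha) m): 12 is one factor 3 and two factors 2. *)
pose Y := 12 * X * expR 1 + 1.
have Y0 : 0 < Y by rewrite ltr_wpDl// !mulr_ge0// expR_ge0.
have a1' : 0 < 1 - alpha by rewrite subr_gt0.
exists (Num.truncn (Y `^ (1 - alpha)^-1)).+1 => m mm.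
have m0 : (0 < m)%N by rewrite (leq_trans _ mm).
have m0' : 0 < m%:R :> R by rewrite ltr0n.
have Ym : Y <= m%:R `^ (1 - alpha).
  have : Y `^ (1 - alpha)^-1 <= m%:R.
    by rewrite (le_trans (ltW (truncnS_gt _)))// ler_nat.
  move=> /(ge0_ler_powR (ltW a1')) h.
  have := h (powR_ge0 _ _) (ltW m0').
  by rewrite -powRrM mulVf ?gt_eqF// powRr1// ltW.
rewrite ler_pdivrMr ?ltr0n ?fact_gt0// mulrAC ler_pdivlMr ?exprn_gt0//.
have h1 : m%:R ^+ m <= m`!%:R * expR 1 ^+ m :> R.
  by rewrite -expRM_natl mulr1; apply: ler_exp_fact; exact: ltW.
rewrite -(@ler_pM2r _ (expR 1 ^+ m)) ?exprn_gt0 ?expR_gt0//.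
apply: (@le_trans _ _ (3 * m%:R ^+ m)); last by rewrite -mulrA ler_wpM2l.
have h2 : m.+2%:R `^ (alpha * m%:R + 1) <= 3 * 3 ^+ m * (m%:R `^ (alpha * m%:R) * 2 ^+ m) :> R.
  have e0 : 0 <= alpha * m%:R by rewrite mulr_ge0// ltW.
  apply: (@le_trans _ _ ((3 * m%:R) `^ (alpha * m%:R + 1))).
    apply: ge0_ler_powR; rewrite ?nnegrE//; first lra.
    by rewrite -natrM ler_nat -addn2 mulSn leq_add2l mul2n -[2%N]/(1.*2)%N leq_double.
  rewrite powRM//.
  apply: ler_pM; rewrite ?powR_ge0//.
    rewrite -exprS -powR_mulrn// ler_powR//; first lra.
    by rewrite -natr1 lerD2r -[leRHS]mul1r ler_wpM2r// ltW.
  rewrite powRD; last by rewrite (gt_eqF m0') implybT.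
  rewrite ler_wpM2l ?powR_ge0// powRr1; last exact: ltW.
  by rewrite -natrX ler_nat ltnW// ltn_expl.
have h3 : Y ^+ m * m%:R `^ (alpha * m%:R) <= m%:R ^+ m.
  have -> : m%:R ^+ m = (m%:R `^ (1 - alpha)) ^+ m * m%:R `^ (alpha * m%:R) :> R.
    rewrite -(@powR_mulrn _ (_ `^ _)) ?powR_ge0// -powRrM -powRD; last first.
      by rewrite (gt_eqF m0') implybT.
    by rewrite -powR_mulrn ?(ltW m0')//; congr (_ `^ _); ring.
  by rewrite ler_wpM2r ?powR_ge0// lerXn2r ?nnegrE ?powR_ge0// ltW.
apply: (@le_trans _ _ (3 * ((12 * X * expR 1) ^+ m * m%:R `^ (alpha * m%:R)))).
  rewrite [leLHS](_ : _ = (X ^+ m * 2 ^+ m * expR 1 ^+ m) * m.+2%:R `^ (alpha * m%:R + 1)); last by ring.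
  rewrite [leRHS](_ : _ = (X ^+ m * 2 ^+ m * expR 1 ^+ m) *
      (3 * 3 ^+ m * (m%:R `^ (alpha * m%:R) * 2 ^+ m))); last first.
    have -> : 12 = 3 * 2 * 2 :> R by ring.
    by rewrite !exprMn; ring.
  by rewrite ler_wpM2l// !mulr_ge0// exprn_ge0// expR_ge0.
rewrite ler_wpM2l//; apply: le_trans h3.
rewrite ler_wpM2r ?powR_ge0// lerXn2r ?nnegrE ?(ltW Y0)//; last by rewrite lerDl.
by rewrite !mulr_ge0// expR_ge0.
Qed.

(** The coefficients of (1 - X)^(-b) exp (- w (1 - X)^alpha), rescaled in space
    by N = n + 1 and in time by N^alpha, converge to the scaled Wright function:
    the limit of the terms is the Gauss limit. *)
Lemma stable_coef_cvg (alpha b r v : R) (k : nat -> nat) : 0 < alpha < 1 ->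
  0 <= b -> 0 < r -> (fun n => (k n).+1%:R / n.+1%:R) @ \oo --> r ->
  (fun n => n.+1%:R `^ (1 - b) * stable_coef alpha b (k n) (v * n.+1%:R `^ alpha))
    @ \oo --> scaled_wright alpha b r v.
Proof.
move=> a01 b0 r0 kr; move: (a01) => /andP[a0 a1].
pose u n m := (- v) ^+ m / m`!%:R *
  (n.+1%:R `^ (1 - (b - alpha * m%:R)) * rising_coef (b - alpha * m%:R) (k n)) : R.
pose l' m := (- (v * r `^ (- alpha))) ^+ m / m`!%:R * (Gamma (- alpha * m%:R + b))^-1 : R.
pose l m := r `^ (b - 1) * l' m.
have lE m : l m = (- v) ^+ m / m`!%:R *
    (r `^ (b - alpha * m%:R - 1) / Gamma (b - alpha * m%:R)).
  rewrite /l /l' -mulNr exprMn mulNr [- _ + b]addrC.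
  have -> : r `^ (b - alpha * m%:R - 1) = r `^ (b - 1) * (r `^ (- alpha)) ^+ m.
    rewrite -(@powR_mulrn _ (_ `^ _)) ?powR_ge0// -powRrM -powRD ?(gt_eqF r0) ?implybT//.
    by congr (_ `^ _); ring.
  by ring.
have uE n : n.+1%:R `^ (1 - b) * stable_coef alpha b (k n) (v * n.+1%:R `^ alpha) =
    limn (series (u n)).
  rewrite /stable_coef -eserZ; last exact: geo_bounded_rising.
  rewrite /eser; congr (limn (series _)); apply/funext => m; rewrite /u.
  have n0 : 0 < n.+1%:R :> R by [].
  have -> : n.+1%:R `^ (1 - (b - alpha * m%:R)) =
      n.+1%:R `^ (1 - b) * (n.+1%:R `^ alpha) ^+ m :> R.
    rewrite -(@powR_mulrn _ (_ `^ _)) ?powR_ge0// -powRrM -powRD ?(gt_eqF n0) ?implybT//.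
    by congr (_ `^ _); ring.
  by rewrite -mulNr exprMn; ring.
have ul m : (fun n => u n m) @ \oo --> l m.
  by rewrite lE; apply: cvgMr; exact: rising_coef_scaled.
(* Z bounds (n + 1) / (k n + 1), whose limit is 1 / r *)
pose Z := 2 / r + 1.
have Z1 : 1 <= Z by rewrite lerDr divr_ge0// ltW.
have X0 : 0 <= `|v| * (Z * expR 1) by rewrite !mulr_ge0 ?expR_ge0//; lra.
have [m1 Hm1] := super_geometric a01 X0.
pose m0 := maxn m1 (Num.truncn (b / alpha)).+1.
have C0 : 0 <= Z * expR 1 * 3 by rewrite !mulr_ge0 ?expR_ge0//; lra.
have [] := @tannery u l (Z * expR 1 * 3) m0 C0 ul.
  near=> n => m mm.
  have y0 : b - alpha * m%:R <= 0.
    have : b / alpha <= m%:R.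
      rewrite (le_trans (ltW (truncnS_gt _)))// ler_nat.
      by rewrite (leq_trans _ mm)// leq_maxr.
    by rewrite ler_pdivrMr//; lra.
  have k0 : 0 < (k n).+1%:R :> R by [].
  have n0 : 0 < n.+1%:R :> R by [].
  have nk : n.+1%:R / (k n).+1%:R <= Z.
    have : r / 2 <= (k n).+1%:R / n.+1%:R.
      by near: n; move/cvgr_ge : kr; apply; lra.
    rewrite ler_pdivlMr// ler_pdivrMr// /Z => h.
    have : 2 / r * (r / 2 * n.+1%:R) <= 2 / r * (k n).+1%:R.
      by rewrite ler_wpM2l// divr_ge0// ltW.
    have -> : 2 / r * (r / 2 * n.+1%:R) = n.+1%:R by field; rewrite gt_eqF.
    by lra.
  set y := b - alpha * m%:R.
  have am : alpha * m%:R <= m%:R by rewrite -[leRHS]mul1r ler_wpM2r// ltW.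
  have Z0 : 0 <= Z := le_trans ler01 Z1.
  have y1 : 0 <= 1 - y by rewrite subr_ge0 (le_trans y0).
  have y2 : 0 <= 2 - y by rewrite subr_ge0 (le_trans y0).
  have y3 : 1 - y <= alpha * m%:R + 1 by clear -b0; rewrite /y; lra.
  have y4 : 1 - y <= m.+1%:R by rewrite (le_trans y3)// -natr1 lerD2r.
  have y5 : 2 - y <= m.+2%:R by clear -y4; rewrite -natr1; lra.
  have h1 := rising_coef_unif (k n) y0.
  have h2 : n.+1%:R `^ (1 - y) <= Z `^ (1 - y) * (k n).+1%:R `^ (1 - y).
    rewrite -powRM//; apply: ge0_ler_powR; rewrite ?nnegrE ?mulr_ge0//.
    by rewrite -ler_pdivrMr.
  have h3 : n.+1%:R `^ (1 - y) * `|rising_coef y (k n)| <=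
      Z ^+ m.+1 * (m.+2%:R `^ (alpha * m%:R + 1) * expR 1 ^+ m.+1).
    apply: (@le_trans _ _ (Z `^ (1 - y) * ((k n).+1%:R `^ (1 - y) * `|rising_coef y (k n)|))).
      by rewrite mulrA ler_wpM2r.
    apply: ler_pM; rewrite ?powR_ge0 ?mulr_ge0 ?powR_ge0//.
      by rewrite -powR_mulrn// ler_powR.
    apply: (le_trans h1); apply: ler_pM; rewrite ?powR_ge0 ?expR_ge0//.
      apply: (@le_trans _ _ (m.+2%:R `^ (1 - y))).
        by apply: ge0_ler_powR; rewrite ?nnegrE.
      by rewrite ler_powR// ler1n.
    by rewrite -expRM_natl mulr1 ler_expR.
  have -> : `|u n m| = `|v| ^+ m / m`!%:R *
      (n.+1%:R `^ (1 - y) * `|rising_coef y (k n)|).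
    rewrite /u -/y; move: (rising_coef _ _) => c.
    by rewrite !normrM normrX normrN normfV !(ger0_norm (ler0n _ _)) ger0_norm ?powR_ge0.
  apply: (@le_trans _ _ (`|v| ^+ m / m`!%:R *
      (Z ^+ m.+1 * (m.+2%:R `^ (alpha * m%:R + 1) * expR 1 ^+ m.+1)))).
    by rewrite ler_wpM2l// divr_ge0// exprn_ge0.
  rewrite [leLHS](_ : _ = Z * expR 1 * ((`|v| * (Z * expR 1)) ^+ m *
      m.+2%:R `^ (alpha * m%:R + 1) / m`!%:R)); last first.
    by rewrite !exprMn !exprS; ring.
  rewrite -[leRHS]mulrA ler_wpM2l ?mulr_ge0 ?expR_ge0//.
  by apply: Hm1; rewrite (leq_trans _ mm)// leq_maxl.
move=> cl; rewrite (_ : limn (series l) = scaled_wright alpha b r v).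
  by apply: cvg_trans; apply: near_eq_cvg; apply: nearW => n; rewrite uE.
rewrite /scaled_wright /wright -/l'.
have p0 : r `^ (b - 1) != 0 by rewrite powR_eq0 negb_and gt_eqF.
have cl' : cvgn (series l').
  have -> : l' = (r `^ (b - 1))^-1 *: l.
    by apply/funext => m; rewrite -[RHS]/(_ * l m) /l mulKf.
  exact: is_cvg_seriesZ.
by rewrite -[RHS]/(_ *: _) -lim_seriesZ.
Unshelve. all: by end_near. Qed.

End tannery.

(** * The identities for the discrete model *)

Section finite_sums.
Context {R : realType}.

Lemma Rintegral_lincomb d (T : measurableType d) (mu : {measure set T -> \bar R})
    (D : set T) (I : Type) (r : seq I) (c : I -> R) (f : I -> T -> R) :
  measurable D -> (forall i, mu.-integrable D (EFin \o f i)) ->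
  mu.-integrable D (EFin \o (fun x => \sum_(i <- r) c i * f i x)) /\
  (\int[mu]_(x in D) (\sum_(i <- r) c i * f i x))%R =
  \sum_(i <- r) c i * (\int[mu]_(x in D) f i x)%R.
Proof.
move=> mD fi; elim: r => [|i r [IH1 IH2]].
  have e : (fun x : T => \sum_(i <- [::]) c i * f i x) = (fun=> 0).
    by apply/funext => x; rewrite big_nil.
  rewrite e big_nil; split; first exact: integrable0.
  by rewrite /Rintegral integral0.
have e : (fun x : T => \sum_(j <- i :: r) c j * f j x) =
    (fun x => c i * f i x + 1 * \sum_(j <- r) c j * f j x).
  by apply/funext => x; rewrite big_cons mul1r.
rewrite e big_cons; split; first exact: integrable_linear.
rewrite RintegralD//.
- by rewrite !RintegralZl// mul1r IH2.
- exact: (integrableZl mD (c i) (fi i)).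
- exact: (integrableZl mD 1 IH1).
Qed.

Lemma sum_triangle (F : nat -> nat -> R) q :
  \sum_(i < q) \sum_(j < i.+1) F (i - j)%N j = \sum_(i < q) \sum_(j < q - i) F i j.
Proof.
elim: q => [|q IH]; first by rewrite !big_ord0.
rewrite big_ord_recr/= IH [RHS](eq_bigr (fun i : 'I_q.+1 =>
    \sum_(j < q - i) F i j + F i (q - i)%N)).
  rewrite big_split/= [in RHS]big_ord_recr/= subnn big_ord0 addr0.
  congr (_ + _); rewrite (reindex_inj rev_ord_inj)/=; apply: eq_bigr => i _.
  by rewrite subSS subKn// -ltnS.
by move=> i _; rewrite subSn ?big_ord_recr// -ltnS.
Qed.

(** Both double sums run over triples i + j + l = M weighted by z_j x_i y_l, the
    first one with i + j < q and the second one with i < q. The difference is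
    the part i < q <= i + j, that is i < q and l < p: the jump j crosses the
    level q. *)
Lemma convolution_exchange (x y z : nat -> R) p q : (0 < p)%N ->
  let M := (p + q).-1 in
  \sum_(i < q) (\sum_(j < i.+1) z j * x (i - j)%N) * y (M - i)%N -
  \sum_(i < q) x i * (\sum_(j < (M - i).+1) z j * y (M - i - j)%N) =
  - \sum_(i < q) \sum_(l < p) z (M - i - l)%N * (x i * y l).
Proof.
move=> p0 M.
have -> : \sum_(i < q) (\sum_(j < i.+1) z j * x (i - j)%N) * y (M - i)%N =
    \sum_(i < q) \sum_(j < q - i) z j * (x i * y (M - i - j)%N).
  rewrite -(sum_triangle (fun i j => z j * (x i * y (M - i - j)%N))).
  apply: eq_bigr => i _; rewrite mulr_suml; apply: eq_bigr => j _.
  rewrite -mulrA; congr (_ * (_ * y _)).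
  by rewrite -subnDA subnK// -ltnS.
have -> : \sum_(i < q) x i * (\sum_(j < (M - i).+1) z j * y (M - i - j)%N) =
    \sum_(i < q) (\sum_(j < q - i) z j * (x i * y (M - i - j)%N) +
                  \sum_(l < p) z (M - i - l)%N * (x i * y l)).
  apply: eq_bigr => i _.
  have Mi : (M - i).+1 = (q - i + p)%N.
    rewrite /M; have := ltn_ord i; move: (nat_of_ord i) => {}i iq.
    rewrite -subSn; last by rewrite -ltnS prednK ?addn_gt0 ?p0// (leq_trans iq)// leq_addl.
    by rewrite prednK ?addn_gt0 ?p0// addnC addnBAC// ltnW.
  rewrite Mi big_split_ord/= mulrDr !mulr_sumr; congr (_ + _).
    by apply: eq_bigr => j _; rewrite mulrCA.
  rewrite (reindex_inj rev_ord_inj)/=; apply: eq_bigr => l _.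
  have e : (q - i + (p - l.+1))%N = (M - i - l)%N.
    by rewrite -[(M - i)%N]/((M - i).+1.-1) Mi addnBA// subnS -predn_sub.
  rewrite e mulrCA; congr (_ * (_ * y _)); rewrite subKn//.
  by rewrite -ltnS Mi (leq_trans (ltn_ord l))// leq_addl.
by rewrite big_split/= opprD addrA subrr sub0r.
Qed.

Lemma continuous_fsum (I : Type) (r : seq I) (f : I -> R -> R) :
  (forall i, continuous (f i)) -> continuous (fun x => \sum_(i <- r) f i x).
Proof.
move=> fc; elim: r => [|i r IH] x.
  rewrite (_ : (fun x => _) = (fun=> 0)); first exact: cvg_cst.
  by apply/funext => y; rewrite big_nil.
rewrite (_ : (fun x => _) = (fun y => f i y + \sum_(j <- r) f j y)).
  by apply: cvgD; [exact: fc|exact: IH].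
by apply/funext => y; rewrite big_cons.
Qed.

End finite_sums.

Section discrete_identity.
Context {R : realType}.
Notation mu := (@lebesgue_measure R).
Variable alpha : R.
Hypothesis alpha01 : 0 < alpha < 1.
Local Notation a := (stable_coef alpha).

Lemma continuous_stable_coef_prod (b kappa u : R) (i l : nat) :
  continuous (fun v : R => a b i (v * kappa) * a b l ((u - v) * kappa)).
Proof.
move=> v; apply: cvgM.
  have h : (fun v : R => v * kappa) x @[x --> v] --> v * kappa.
    by apply: cvgM; [exact: cvg_id|exact: cvg_cst].
  exact: (cvg_comp _ _ h (@continuous_stable_coef _ _ alpha01 b i (v * kappa))).
have h : (fun v : R => (u - v) * kappa) x @[x --> v] --> (u - v) * kappa.
  by apply: cvgM; [apply: cvgB; [exact: cvg_cst|exact: cvg_id]|exact: cvg_cst].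
exact: (cvg_comp _ _ h (@continuous_stable_coef _ _ alpha01 b l ((u - v) * kappa))).
Qed.

Lemma integrable_stable_coef_prod (b kappa u : R) (i l : nat) :
  mu.-integrable `]0, u[
    (EFin \o (fun v : R => a b i (v * kappa) * a b l ((u - v) * kappa))).
Proof.
have : mu.-integrable `[0, u]
    (EFin \o (fun v : R => a b i (v * kappa) * a b l ((u - v) * kappa))).
  apply: continuous_compact_integrable; first exact: segment_compact.
  by apply: continuous_subspaceT; exact: continuous_stable_coef_prod.
by apply: integrableS => //; apply: subset_itv; rewrite bnd_simp.
Qed.

(** Integration over ]0, u[ of the derivative of
    v |-> sum_(i < q) a_i(v) a_(M - i)(u - v), which by convolution_exchange
    consists of the jumps over the level q. The factor kappa is the scaling of
    time. *)
Lemma discrete_identity (b kappa u : R) p q : (0 < p)%N -> 0 < u ->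
  let M := (p + q).-1 in
  \sum_(i < q) rising_coef b i * a b (M - i)%N (u * kappa) -
  \sum_(i < q) a b i (u * kappa) * rising_coef b (M - i)%N =
  \sum_(i < q) \sum_(l < p) (kappa * - rising_coef (- alpha) (M - i - l)%N) *
    (\int[mu]_(v in `]0, u[) (a b i (v * kappa) * a b l ((u - v) * kappa)))%R.
Proof.
move=> p0 u0 M.
pose P (v : R) : R := \sum_(i < q) a b i (v * kappa) * a b (M - i)%N ((u - v) * kappa).
pose dP (v : R) : R := \sum_(i < q) \sum_(l < p)
  (kappa * rising_coef (- alpha) (M - i - l)%N) *
  (a b i (v * kappa) * a b l ((u - v) * kappa)).
have PdP (v : R) : is_derive v 1 P (dP v).
  have -> : dP v = \sum_(i < q)
     (a b i (v * kappa) *: (a (b - alpha) (M - i)%N ((u - v) * kappa) * kappa) +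
     a b (M - i)%N ((u - v) * kappa) *: (- a (b - alpha) i (v * kappa) * kappa)).
    rewrite /dP; have := convolution_exchange (fun i => a b i (v * kappa))
      (fun i => a b i ((u - v) * kappa)) (fun i => rising_coef (- alpha) i) q p0.
    rewrite -/M => /= h.
    transitivity (kappa * \sum_(i < q) \sum_(l < p) rising_coef (- alpha) (M - i - l) *
      (a b i (v * kappa) * a b l ((u - v) * kappa))).
      rewrite mulr_sumr; apply: eq_bigr => i _; rewrite mulr_sumr.
      by apply: eq_bigr => l _; rewrite -mulrA.
    rewrite -[X in kappa * X]opprK -h opprB mulrBr !mulr_sumr -sumrB.
    apply: eq_bigr => i _.
    rewrite -!stable_coefD// ![- alpha + b]addrC /GRing.scale/=; ring.
  have -> : P = \sum_(i < q) (fun v => a b i (v * kappa) * a b (M - i)%N ((u - v) * kappa)).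
    by apply/funext => y; rewrite /P fct_sumE.
  apply: is_derive_sum => i.
  have d1 (x : R) : is_derive x 1 (fun v : R => v * kappa) kappa.
    rewrite (_ : (fun v : R => v * kappa) = kappa \*: (id : R -> R)); last first.
      by apply/funext => y; rewrite mulrC.
    by rewrite -[X in is_derive _ _ _ X]mulr1; apply: is_deriveZ.
  have e1 : is_derive v 1 (fun v : R => a b i (v * kappa)) (- a (b - alpha) i (v * kappa) * kappa).
    apply: (@is_derive1_comp _ (a b i) (fun v : R => v * kappa)) => //.
    exact: is_derive_stable_coef.
  have e2 : is_derive v 1 (fun v : R => a b (M - i)%N ((u - v) * kappa))
      (a (b - alpha) (M - i)%N ((u - v) * kappa) * kappa).
    rewrite -[X in is_derive _ _ _ X]mulrNN.
    apply: (@is_derive1_comp _ (a b (M - i)%N) (fun v : R => (u - v) * kappa)).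
      exact: is_derive_stable_coef.
    rewrite -mulrN1; apply: (@is_derive1_comp _ (fun v : R => v * kappa) (fun v : R => u - v)) => //.
    rewrite -[X in is_derive _ _ _ X]sub0r.
    by apply: (@is_deriveB _ _ _ (cst u) id).
  exact: (@is_deriveM _ _ (fun v : R => a b i (v * kappa))).
have cP (v : R) : {for v, continuous P}.
  by have [h _] := PdP v; apply: differentiable_continuous; apply/derivable1_diffP.
have ci i l := integrable_stable_coef_prod b kappa u i l.
have mI : measurable (`]0, u[%classic : set (measurableTypeR R)) by [].
have dPi (i : 'I_q) := @Rintegral_lincomb _ _ _ _ _ _ (index_enum 'I_p)
   (fun l : 'I_p => kappa * rising_coef (- alpha) (M - i - l)%N) _ mI (ci i).
have [dPint] := @Rintegral_lincomb _ _ _ _ _ _ (index_enum 'I_q)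
   (fun=> 1) _ mI (fun i => (dPi i).1).
under [X in _ = X -> _]eq_bigr => i _ do rewrite mul1r (dPi i).2.
have -> : (fun x => \sum_(i <- index_enum 'I_q) 1 * \sum_(i0 <- index_enum 'I_p)
    kappa * rising_coef (- alpha) (M - i - i0) *
    (a b i (x * kappa) * a b i0 ((u - x) * kappa))) = dP.
  by apply/funext => x; apply: eq_bigr => i _; rewrite mul1r.
have cdP : continuous dP.
  apply: continuous_fsum => i; apply: continuous_fsum => l v.
  by apply: cvgMr; exact: continuous_stable_coef_prod.
have -> : (\int[mu]_(v in `]0, u[) dP v)%R = P u - P 0.
  rewrite /Rintegral -(@integral_itv_bndoo _ 0 u _ true false); last first.
    by apply/measurable_EFinP; apply: measurable_funTS; exact: continuous_measurable_fun.
  rewrite (@continuous_FTC2 _ dP P)//.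
  - exact: continuous_subspaceT.
  - split; first by move=> v _; have [] := PdP v.
      by apply: cvg_at_right_filter; exact: cP.
    by apply: cvg_at_left_filter; exact: cP.
  - by move=> v _; rewrite derive1E; have [_ ->] := PdP v.
rewrite /P => h.
rewrite [RHS](_ : _ = - \sum_(i < q) \sum_(l < p) (kappa * rising_coef (- alpha) (M - i - l)%N) *
    (\int[mu]_(v in `]0, u[) (a b i (v * kappa) * a b l ((u - v) * kappa)))%R); last first.
  rewrite -sumrN; apply: eq_bigr => i _; rewrite -sumrN; apply: eq_bigr => l _.
  by rewrite mulrN mulNr.
rewrite -h opprB; congr (_ - _); apply: eq_bigr => i _.
  by rewrite mul0r subr0 stable_coef_at0.
by rewrite subrr mul0r stable_coef_at0.
Qed.

End discrete_identity.

(** * Riemann sums as integrals of step functions *)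

Section step_functions.
Context {R : realType}.
Notation mu := (@lebesgue_measure R).
Implicit Types (F : nat -> R) (B r : R) (n h k : nat).

Definition grid n r : nat := Num.truncn (n.+1%:R * r).

Lemma gridP n r : 0 <= r ->
  (grid n r)%:R / n.+1%:R <= r < (grid n r).+1%:R / n.+1%:R.
Proof.
move=> r0; rewrite ler_pdivrMr// ltr_pdivlMr// mulrC.
by apply: truncn_itv; rewrite mulr_ge0.
Qed.

Definition step n h F r : R := if (grid n r < h)%N then F (grid n r) else 0.

Lemma stepE n h F r : 0 <= r -> step n h F r =
  \sum_(i < h) F i * \1_`[i%:R / n.+1%:R, i.+1%:R / n.+1%:R[ r.
Proof.
move=> r0.
have ind i : \1_`[i%:R / n.+1%:R, i.+1%:R / n.+1%:R[ r = (grid n r == i)%:R :> R.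
  rewrite indicE mem_setE in_itv/= ler_pdivrMr// ltr_pdivlMr// [r * _]mulrC.
  by rewrite /grid truncn_eq ?mulr_ge0.
rewrite /step; case: ifPn => [gh|gh].
  rewrite (bigD1 (Ordinal gh))//= ind eqxx mulr1 big1 ?addr0// => i ig.
  rewrite ind; case: eqP => [e|]; last by rewrite mulr0.
  by move: ig; rewrite -val_eqE/= e eqxx.
rewrite big1// => i _; rewrite ind; case: eqP => [e|]; last by rewrite mulr0.
by rewrite e ltn_ord in gh.
Qed.

Lemma step_integral n h F B : h%:R / n.+1%:R <= B ->
  mu.-integrable `]0, B[ (EFin \o step n h F) /\
  (\int[mu]_(r in `]0, B[) step n h F r)%R = n.+1%:R^-1 * \sum_(i < h) F i.
Proof.
move=> hB.
have mB : measurable (`]0, B[%classic : set (measurableTypeR R)) by [].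
pose A i : set R := `[i%:R / n.+1%:R, i.+1%:R / n.+1%:R[%classic.
have mA i : measurable (A i : set (measurableTypeR R)) by exact: measurable_itv.
have iA i : mu.-integrable `]0, B[ (EFin \o (\1_(A i) : R -> R)).
  apply: integrableS (integrable_indic_itv (i%:R / n.+1%:R) (i.+1%:R / n.+1%:R) true true) => //.
have IA (i : 'I_h) : (\int[mu]_(r in `]0, B[) (\1_(A i) r))%R = n.+1%:R^-1.
  rewrite /Rintegral -(@integral_itv_bndoo _ 0 B _ true true); last first.
    by case/integrableP : (iA i).
  rewrite integral_indic// (_ : _ `&` _ = A i); last first.
    apply/seteqP; split => [r []//|r Ar]; split=> //; move: Ar.
    rewrite /A/= !in_itv/= => /andP[r1 r2]; apply/andP; split.
      by rewrite (le_trans _ r1)// divr_ge0.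
    rewrite (lt_le_trans r2)// (le_trans _ hB)// ler_wpM2r ?invr_ge0//.
    by rewrite ler_nat.
  rewrite -[LHS]/(fine (mu (A i))) /A lebesgue_measure_itv/= lte_fin.
  rewrite ltr_pM2r ?invr_gt0// ltr_nat ltnSn.
  by rewrite -EFinB/= -mulrBl -natr1 addrAC subrr add0r mul1r.
have [i1 I1] := @Rintegral_lincomb R _ (measurableTypeR R) mu _ _
  (index_enum 'I_h) (fun i => F i) (fun i => \1_(A i) : R -> R) mB (fun i => iA i).
have e r : `]0, B[%classic r -> step n h F r = \sum_(i < h) F i * \1_(A i) r.
  by rewrite /= in_itv/= => /andP[r0 _]; apply: stepE; exact: ltW.
split.
  move: i1; apply: eq_integrable => // r /set_mem rB.
  by rewrite /= e.
transitivity (\int[mu]_(r in `]0%R, B[) \sum_(i < h) F i * \1_(A i) r)%R.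
  by apply: eq_Rintegral => r /set_mem rB; rewrite e.
rewrite I1 mulr_sumr; apply: eq_bigr => i _.
by rewrite IA mulrC.
Qed.

Lemma step_norm_le n h F B (D : R -> R) : h%:R / n.+1%:R <= B ->
  mu.-integrable `]0, B[ (EFin \o D) ->
  (forall r, 0 < r < B -> 0 <= D r) ->
  (forall r, 0 < r < B -> (grid n r < h)%N -> `|F (grid n r)| <= D r) ->
  `|n.+1%:R^-1 * \sum_(i < h) F i| <= (\int[mu]_(r in `]0, B[) D r)%R.
Proof.
move=> hB Di D0 FD.
have mB : measurable (`]0, B[%classic : set (measurableTypeR R)) by [].
have [i1 <-] := step_integral F hB.
rewrite (le_trans (le_normr_Rintegral mB i1))//.
apply: le_Rintegral => //; first exact: integrable_norm.
move=> r /=; rewrite in_itv/= => rB; rewrite /step.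
by case: ifPn => [|_]; [exact: FD|rewrite normr0 D0].
Qed.

(** The sums are integrals of step functions. The domination may start at a late
    n, but it has to be uniform in r from there on. *)
Lemma step_dominated_convergence B (h : nat -> nat) (F : nat -> nat -> R) (f D : R -> R) :
  (forall n, (h n)%:R / n.+1%:R <= B) ->
  (forall r, 0 < r < B -> \forall n \near \oo, (grid n r < h n)%N) ->
  mu.-integrable `]0, B[ (EFin \o D) ->
  (forall r, 0 < r < B -> 0 <= D r) ->
  (\forall n \near \oo, forall r, 0 < r < B -> (grid n r < h n)%N ->
     `|F n (grid n r)| <= D r) ->
  (forall r, 0 < r < B -> (fun n => F n (grid n r)) @ \oo --> f r) ->
  mu.-integrable `]0, B[ (EFin \o f) /\
  (fun n => n.+1%:R^-1 * \sum_(i < h n) F n i) @ \oo -->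
    (\int[mu]_(r in `]0, B[) f r)%R.
Proof.
move=> hB hr Di D0 [n0 _ FD] Ff.
have mB : measurable (`]0, B[%classic : set (measurableTypeR R)) by [].
have [||r|||fi cv] := @real_dominated_convergence _ (measurableTypeR R) R mu
  `]0, B[%classic (fun n => step (n + n0) (h (n + n0)%N) (F (n + n0)%N)) f D.
- by [].
- move=> n; have [/integrableP[mS _] _] := step_integral (F (n + n0)%N) (hB (n + n0)%N).
  exact/measurable_EFinP.
- rewrite /= in_itv/= => rB.
  rewrite (cvg_shiftn n0 (fun n => step n (h n) (F n) r)).
  apply: cvg_trans (Ff r rB); apply: near_eq_cvg.
  by near=> n; rewrite /step ifT//; near: n; exact: hr.
- exact: Di.
- move=> n r; rewrite /= in_itv/= => rB; rewrite /step.
  by case: ifPn => [|_]; [apply: FD => //; exact: leq_addl|rewrite normr0 D0].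
split=> //; rewrite -(cvg_shiftn n0).
apply: cvg_trans cv; apply: near_eq_cvg; apply: nearW => n.
by have [_ ->] := step_integral (F (n + n0)%N) (hB (n + n0)%N).
Unshelve. all: by end_near. Qed.

Lemma cvg_gridS r : 0 <= r -> (fun n => (grid n r).+1%:R / n.+1%:R) @ \oo --> r.
Proof.
move=> r0.
apply: (@squeeze_cvgr _ _ _ _ (fun=> r) (fun n => r + 1 / n.+1%:R)).
- apply: nearW => n; have /andP[h1 h2] := gridP n r0.
  by rewrite ltW//= -natr1 mulrDl lerD2r.
- exact: cvg_cst.
- rewrite -[X in _ --> X]addr0; apply: cvgD; first exact: cvg_cst.
  exact: cvg_inv_natS.
Qed.

Lemma near_grid_lt r B (h : nat -> nat) : 0 <= r -> r < B ->
  (fun n => (h n)%:R / n.+1%:R) @ \oo --> B ->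
  \forall n \near \oo, (grid n r < h n)%N.
Proof.
move=> r0 rB hB; near=> n.
have h1 : r < (h n)%:R / n.+1%:R by near: n; move/cvgr_gt : hB; exact.
have /andP[h2 _] := gridP n r0.
rewrite -(ltr_nat R) -(@ltr_pM2r _ n.+1%:R^-1) ?invr_gt0//.
exact: le_lt_trans h2 h1.
Unshelve. all: by end_near. Qed.

End step_functions.

(** * The double integral as a limit of double sums *)

Lemma Gamma_opp (R : realType) (alpha : R) : 0 < alpha < 1 ->
  Gamma (- alpha) = - (Gamma (1 - alpha) / alpha).
Proof.
move=> /andP[a0 a1]; rewrite {1}/Gamma.
rewrite oppr_gt0 ltNge (ltW a0)/= opprK.
rewrite (@truncn_def _ alpha 0); last by rewrite (ltW a0).
rewrite big_ord1 addr0 /Gamma subr_gt0 a1 [- alpha + 1]addrC.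
by rewrite invrN mulrN.
Qed.

(** For x in [r, B] with only r tending to 0, the power of x is controlled by one
    of r whose exponent is at most 0, whatever the sign of e - 1. *)
Lemma powR_cap (R : realType) (e r x B : R) : 0 < r -> r <= x -> x <= B ->
  x `^ (e - 1) <= B `^ (e - Num.min e 1) * r `^ (Num.min e 1 - 1).
Proof.
move=> r0 rx xB.
have x0 : 0 < x := lt_le_trans r0 rx.
have m1 : Num.min e 1 <= 1 by rewrite ge_min lexx orbT.
have me : Num.min e 1 <= e by rewrite ge_min lexx.
have -> : e - 1 = (e - Num.min e 1) + (Num.min e 1 - 1) by ring.
rewrite powRD; last by rewrite (gt_eqF x0) implybT.
apply: ler_pM; rewrite ?powR_ge0//.
  by apply: ge0_ler_powR; rewrite ?nnegrE ?subr_ge0// ltW// (lt_le_trans x0).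
rewrite -(opprB 1 (Num.min e 1)) !powRN lef_pV2 ?posrE ?powR_gt0//.
by apply: ge0_ler_powR; rewrite ?nnegrE ?subr_ge0// ltW.
Qed.

Section approximation.
Context {R : realType}.
Notation mu := (@lebesgue_measure R).
Variables (alpha b : R).
Hypotheses (alpha01 : 0 < alpha < 1) (b0 : 0 <= b).
Local Notation a := (stable_coef alpha).

(** The discrete counterpart at mesh 1 / (n + 1) of scaled_wright alpha b. *)
Definition wright_approx n k (v : R) : R :=
  n.+1%:R `^ (1 - b) * a b k (v * n.+1%:R `^ alpha).

Local Notation psi := wright_approx.
Local Notation e := (b + alpha / 2).

Lemma wright_approx_ge0 n k v : 0 <= v -> 0 <= psi n k v.
Proof.
move=> v0; rewrite mulr_ge0 ?powR_ge0// stable_coef_ge0// mulr_ge0// powR_ge0//.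
Qed.

(** The case theta = 1 / 2 of stable_coef_le: the exponent - 1 / 2 is integrable
    in v at 0, and the exponent of k exceeds b - 1 by alpha / 2. *)
Lemma wright_approx_le : exists2 C, 0 <= C & forall n k v, 0 < v ->
  psi n k v <= C * (k.+1%:R / n.+1%:R) `^ (e - 1) * v `^ (2^-1 - 1).
Proof.
have h0 : 0 <= 2^-1 :> R by [].
have [C C0 H] := stable_coef_le alpha01 b0 h0.
exists C => // n k v v0.
have n0 : 0 < n.+1%:R :> R by [].
have k0 : 0 < k.+1%:R :> R by [].
have na : 0 < n.+1%:R `^ alpha :> R by rewrite powR_gt0.
have w0 : 0 < v * n.+1%:R `^ alpha by rewrite mulr_gt0.
have h1 := H k _ (ltW w0).
rewrite -ler_pdivlMr ?powR_gt0// in h1.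
rewrite /psi; apply: (le_trans (ler_wpM2l (powR_ge0 _ _) h1)).
rewrite powRM ?(ltW v0) ?powR_ge0// -powRrM powRM ?invr_ge0//.
have -> : n.+1%:R^-1 `^ (e - 1) = n.+1%:R `^ (1 - b) / n.+1%:R `^ (alpha * 2^-1) :> R.
  rewrite -powR_inv1 ?ltW// -powRrM -powRN -powRD ?(gt_eqF n0) ?implybT//.
  by congr (_ `^ _); ring.
have -> : v `^ (2^-1 - 1) = (v `^ 2^-1)^-1.
  by rewrite -powRN; congr (_ `^ _); lra.
have -> : b - 1 + alpha * 2^-1 = e - 1 by ring.
rewrite le_eqVlt; apply/orP; left; apply/eqP.
have A0 : v `^ 2^-1 != 0 by rewrite gt_eqF// powR_gt0.
have B0 : n.+1%:R `^ (alpha / 2) != 0 :> R by rewrite gt_eqF// powR_gt0.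
by field; rewrite A0 B0.
Qed.

Lemma wright_approx_continuous n k : continuous (psi n k).
Proof.
move=> v; apply: cvgMr.
have h : (fun v : R => v * n.+1%:R `^ alpha) x @[x --> v] --> v * n.+1%:R `^ alpha.
  by apply: cvgM; [exact: cvg_id|exact: cvg_cst].
exact: (cvg_comp _ _ h (@continuous_stable_coef _ _ alpha01 b k _)).
Qed.

Lemma measurable_wright_approx (D : set R) n k : measurable_fun D (psi n k).
Proof.
by apply: measurable_funTS; apply: continuous_measurable_fun; exact: wright_approx_continuous.
Qed.

Lemma measurable_wright_approx_subr (D : set R) n k u :
  measurable_fun D (fun v => psi n k (u - v)).
Proof.
apply: measurable_funTS; apply: (@measurableT_comp _ _ _ _ _ _ (psi n k)).
  exact: measurable_wright_approx.
by apply: measurable_funB.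
Qed.

Variable u : R.
Hypothesis u0 : 0 < u.

Definition conv_approx n l i : R :=
  \int[mu]_(v in `]0, u[) (psi n l (u - v) * psi n i v)%R.

Let half01 : 0 < (2^-1 : R) <= 1.
Proof. by rewrite invr_gt0 ltr0n/= invf_le1// ler1n. Qed.

Let beta_half v : R := v `^ (2^-1 - 1) * (u - v) `^ (2^-1 - 1).

Let beta_half_integrable : mu.-integrable `]0, u[ (EFin \o beta_half).
Proof. exact: integrable_beta. Qed.

Lemma conv_approx_pointwise : exists2 C, 0 <= C & forall n l i v, 0 < v < u ->
  0 <= psi n l (u - v) * psi n i v <=
  C * ((l.+1%:R / n.+1%:R) `^ (e - 1) * (i.+1%:R / n.+1%:R) `^ (e - 1)) * beta_half v.
Proof.
have [C C0 H] := wright_approx_le.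
exists (C * C) => [|n l i v /andP[v0 vu]]; first exact: mulr_ge0.
have uv : 0 < u - v by rewrite subr_gt0.
have p1 := wright_approx_ge0 n l (ltW uv).
have p2 := wright_approx_ge0 n i (ltW v0).
rewrite mulr_ge0//= (le_trans (ler_pM p1 p2 (H n l _ uv) (H n i _ v0)))//.
by rewrite le_eqVlt; apply/orP; left; apply/eqP; rewrite /beta_half; ring.
Qed.

Lemma measurable_conv_approx (D : set R) n l i :
  measurable_fun D (fun v => psi n l (u - v) * psi n i v).
Proof.
apply: measurable_funM; first exact: measurable_wright_approx_subr.
exact: measurable_wright_approx.
Qed.

Lemma conv_approx_le : exists2 C, 0 <= C & forall n l i, `|conv_approx n l i| <=
  C * ((l.+1%:R / n.+1%:R) `^ (e - 1) * (i.+1%:R / n.+1%:R) `^ (e - 1)).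
Proof.
have [C C0 H] := conv_approx_pointwise.
have mI : measurable (`]0, u[%classic : set (measurableTypeR R)) by [].
have B0 : 0 <= (\int[mu]_(v in `]0, u[) beta_half v)%R.
  by apply: Rintegral_ge0 => v _; rewrite mulr_ge0 ?powR_ge0.
exists (C * (\int[mu]_(v in `]0, u[) beta_half v)%R) => [|n l i]; first exact: mulr_ge0.
set X := _ * _ `^ _.
have gi : mu.-integrable `]0, u[ (EFin \o (fun v => C * X * beta_half v)).
  exact: (integrableZl mI (C * X) beta_half_integrable).
have fi : mu.-integrable `]0, u[ (EFin \o (fun v => psi n l (u - v) * psi n i v)).
  apply: integrable_le gi => //; first exact: measurable_conv_approx.
  move=> v; rewrite /= in_itv/= => /(H n l i)/andP[h1 h2].
  by rewrite ger0_norm.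
rewrite ger0_norm; last first.
  by apply: Rintegral_ge0 => v; rewrite /= in_itv/= => /(H n l i)/andP[].
rewrite mulrAC -RintegralZl//.
apply: le_Rintegral => // v.
by rewrite /= in_itv/= => /(H n l i)/andP[].
Qed.

Lemma conv_approx_cvg (r1 r2 : R) (l i : nat -> nat) : 0 < r1 -> 0 < r2 ->
  (fun n => (l n).+1%:R / n.+1%:R) @ \oo --> r1 ->
  (fun n => (i n).+1%:R / n.+1%:R) @ \oo --> r2 ->
  mu.-integrable `]0, u[ (EFin \o (fun v =>
     scaled_wright alpha b r1 (u - v) * scaled_wright alpha b r2 v)) /\
  (fun n => conv_approx n (l n) (i n)) @ \oo -->
  (\int[mu]_(v in `]0, u[)
     (scaled_wright alpha b r1 (u - v) * scaled_wright alpha b r2 v))%R.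
Proof.
move=> r10 r20 lr ir.
have [C C0 H] := conv_approx_pointwise.
pose X n : R := ((l n).+1%:R / n.+1%:R) `^ (e - 1) * ((i n).+1%:R / n.+1%:R) `^ (e - 1).
have cX : X @ \oo --> r1 `^ (e - 1) * r2 `^ (e - 1).
  by apply: cvgM; apply: cvg_powR1.
have /cvg_seq_bounded [M [_ HM]] : cvgn X by apply/cvg_ex; eexists; exact: cX.
have {}HM k := HM (`|M| + 1) (ltr_pwDr ltr01 (ler_norm M)) k Logic.I.
have mI : measurable (`]0, u[%classic : set (measurableTypeR R)) by [].
apply: (@real_dominated_convergence _ (measurableTypeR R) R mu
  `]0, u[%classic (fun n v => psi n (l n) (u - v) * psi n (i n) v) _
  (fun v => C * (`|M| + 1) * beta_half v)).
- by [].
- by move=> n; exact: measurable_conv_approx.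
- move=> v _; apply: cvgM; exact: stable_coef_cvg.
- exact: (integrableZl mI (C * (`|M| + 1)) beta_half_integrable).
- move=> n v; rewrite /= in_itv/= => /(H n (l n) (i n))/andP[h1 h2].
  rewrite ger0_norm// (le_trans h2)//.
  rewrite ler_wpM2r ?mulr_ge0 ?powR_ge0// ler_wpM2l//.
  exact: le_trans (ler_norm _) (HM n).
Qed.

(** The rescaled jump weights of the discrete model. The factor
    Gamma (- alpha) = - Gamma (1 - alpha) / alpha makes them positive and their
    limit equal to y^(- 1 - alpha). *)
Definition kernel_approx n j : R :=
  n.+1%:R `^ (1 + alpha) * (Gamma (- alpha) * rising_coef (- alpha) j).

Lemma kernel_approx_le : exists2 C, 0 <= C & forall n j,
  `|kernel_approx n j| <= C * ((j.+1%:R / n.+1%:R) `^ (1 + alpha))^-1.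
Proof.
have [C C0 H] := rising_coef_le (- alpha).
exists (`|Gamma (- alpha)| * C) => [|n j]; first exact: mulr_ge0.
have n0 : 0 < n.+1%:R :> R by [].
have k0 : 0 < j.+1%:R :> R by [].
rewrite /kernel_approx normrM [`|_ `^ _|]ger0_norm ?powR_ge0// normrM.
rewrite powRM ?invr_ge0//.
have -> : n.+1%:R^-1 `^ (1 + alpha) = (n.+1%:R `^ (1 + alpha))^-1 :> R.
  by rewrite -powR_inv1 ?ltW// -powRrM mulN1r powRN.
have h := H j; rewrite -opprD addrC powRN addrC in h.
rewrite invfM invrK [1 + alpha]addrC.
rewrite [leRHS](_ : _ = `|Gamma (- alpha)| *
    (n.+1%:R `^ (alpha + 1) * (C / j.+1%:R `^ (alpha + 1)))); last by ring.
by rewrite mulrCA ler_wpM2l// ler_wpM2l ?powR_ge0.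
Qed.

Lemma kernel_approx_cvg (y : R) (j : nat -> nat) : 0 < y ->
  (fun n => (j n).+1%:R / n.+1%:R) @ \oo --> y ->
  (fun n => kernel_approx n (j n)) @ \oo --> (y `^ (1 + alpha))^-1.
Proof.
move=> y0 jy; move: (alpha01) => /andP[a0 a1].
have h := @rising_coef_scaled _ (- alpha) y j y0 jy.
have G0 : Gamma (- alpha) != 0.
  rewrite Gamma_opp// oppr_eq0 mulf_neq0 ?invr_eq0 ?gt_eqF//.
  by rewrite /Gamma subr_gt0 a1 euler_integral_gt0// subr_gt0.
have -> : (y `^ (1 + alpha))^-1 = Gamma (- alpha) * (y `^ (- alpha - 1) / Gamma (- alpha)).
  rewrite mulrCA divff// mulr1 -powRN; congr (_ `^ _); ring.
apply: cvg_trans (cvgMr (a := Gamma (- alpha)) h).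
apply: near_eq_cvg; apply: nearW => n; rewrite /kernel_approx opprK.
by rewrite mulrCA.
Qed.

(** AM-GM splits the singularity of the kernel at the corner (t, s) into two
    integrable endpoint singularities. *)
Lemma kernel_split (x y z : R) : 0 < x -> 0 < y -> (x + y) / 2 <= z ->
  (z `^ (1 + alpha))^-1 <= x `^ ((1 - alpha) / 2 - 1) * y `^ ((1 - alpha) / 2 - 1).
Proof.
move=> x0 y0 xyz; move: (alpha01) => /andP[a0 a1].
have z0 : 0 < z by lra.
rewrite -powRM ?(ltW x0) ?(ltW y0)//.
have -> : (1 - alpha) / 2 - 1 = - ((1 + alpha) / 2) by lra.
rewrite powRN lef_pV2 ?posrE ?powR_gt0 ?mulr_gt0//.
have -> : z `^ (1 + alpha) = (z ^+ 2) `^ ((1 + alpha) / 2).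
  by rewrite -powR_mulrn ?(ltW z0)// -powRrM; congr (_ `^ _); field.
apply: ge0_ler_powR; rewrite ?nnegrE ?mulr_ge0 ?exprn_ge0 ?(ltW x0) ?(ltW y0) ?(ltW z0)//.
  by rewrite addr_ge0// ltW.
apply: (@le_trans _ _ (((x + y) / 2) ^+ 2)).
  have : 0 <= (x - y) ^+ 2 by exact: sqr_ge0.
  by rewrite !expr2; lra.
by rewrite lerXn2r ?nnegrE ?(ltW z0)//; lra.
Qed.

End approximation.

Section grid_cuts.
Context {R : realType}.
Implicit Types (r t s : R) (n : nat).

Lemma cvg_grid r : 0 <= r -> (fun n => (grid n r)%:R / n.+1%:R) @ \oo --> r.
Proof.
move=> r0; rewrite -[X in _ --> X](subr0 r).
apply: cvg_trans (cvgB (cvg_gridS r0) (cvg_inv_natS (1 : R))).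
apply: near_eq_cvg; apply: nearW => n /=.
rewrite -[LHS]/((grid n r).+1%:R / n.+1%:R - 1 / n.+1%:R).
by rewrite -[(grid n r).+1%:R]natr1 mulrDl addrK.
Qed.

(** The factor 2 compensates for the rounding: the gap in cells, at least 1, may
    fall short of the distance by one cell. *)
Lemma grid_gap n r t : 0 <= r -> (grid n r < grid n t)%N -> 0 <= t ->
  t - r <= 2 * ((grid n t - grid n r)%N%:R / n.+1%:R).
Proof.
move=> r0 rt t0.
have /andP[r1 r2] := gridP n r0; have /andP[t1 t2] := gridP n t0.
have h : 1 / n.+1%:R <= (grid n t - grid n r)%N%:R / n.+1%:R :> R.
  by rewrite ler_wpM2r ?invr_ge0// ler1n subn_gt0.
rewrite natrB ?(ltnW rt)// mulrBl in h *.
rewrite -[(grid n t).+1%:R]natr1 mulrDl in t2.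
move: h t2 r1; move: (1 / _) ((grid n t)%:R / _) ((grid n r)%:R / _) => x y z.
by move=> h t2 r1; lra.
Qed.

Lemma cut_succ n (p q l i : nat) : (l < p)%N -> (i < q)%N ->
  ((p + q).-1 - i - l).+1 = (p - l + (q - i))%N.
Proof.
move=> lp iq; lia.
Qed.

End grid_cuts.

Section double_integral_limit.
Context {R : realType}.
Notation mu := (@lebesgue_measure R).
Variables (alpha b t s u : R).
Hypotheses (alpha01 : 0 < alpha < 1) (b0 : 0 <= b).
Hypotheses (t0 : 0 < t) (s0 : 0 < s) (u0 : 0 < u).

Local Notation p n := (grid n t).
Local Notation q n := (grid n s).
Local Notation e := (Num.min (b + alpha / 2) 1).
Local Notation g := ((1 - alpha) / 2).

(** With p n and q n cells for t and s, the level t + s is the index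
    (p n + q n).-1, so that every jump over the level has length at least 1. *)
Definition double_term n l i : R :=
  kernel_approx alpha n ((p n + q n).-1 - i - l) * conv_approx alpha b u n l i.

Let dom T r : R := r `^ (e - 1) * (T - r) `^ (g - 1).

Let e01 : 0 < e <= 1.
Proof.
move: alpha01 => /andP[a0 a1].
by rewrite lt_min ltr01 andbT ge_min lexx orbT andbT ltr_wpDl// divr_gt0.
Qed.

Let g01 : 0 < g <= 1.
Proof. by move: alpha01 => /andP[a0 a1]; apply/andP; split; lra. Qed.

Let dom_integrable T : 0 < T -> mu.-integrable `]0, T[ (EFin \o dom T).
Proof. by move=> T0; apply: integrable_beta. Qed.

Let dom_ge0 T r : 0 <= dom T r.
Proof. by rewrite mulr_ge0 ?powR_ge0. Qed.

Lemma grid_powR_le n r T : 0 < r < T -> (grid n r < grid n T)%N ->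
  ((grid n r).+1%:R / n.+1%:R) `^ (b + alpha / 2 - 1) <=
  T `^ (b + alpha / 2 - e) * r `^ (e - 1).
Proof.
move=> /andP[r0 rT] h; have T0 := lt_trans r0 rT.
have /andP[_ r2] := gridP n (ltW r0); have /andP[h1 _] := gridP n (ltW T0).
apply: powR_cap => //; first exact: ltW.
by rewrite (le_trans _ h1)// ler_wpM2r ?invr_ge0// ler_nat.
Qed.

(** The beta-type weights in r1 and r2 combine the bounds on the two coefficients
    at 0 with the two halves of the kernel at t and s. *)
Lemma double_term_le : exists2 C, 0 <= C & forall n r1 r2, 0 < r1 < t -> 0 < r2 < s ->
  (grid n r1 < p n)%N -> (grid n r2 < q n)%N ->
  `|double_term n (grid n r1) (grid n r2)| <= C * (dom t r1 * dom s r2).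
Proof.
have [C1 C10 H1] := conv_approx_le alpha01 b0 u0.
have [C2 C20 H2] := kernel_approx_le alpha.
pose Ct := t `^ (b + alpha / 2 - e); pose Cs := s `^ (b + alpha / 2 - e).
exists (C2 * C1 * (Ct * Cs)) => [|n r1 r2 r1t r2s h1 h2].
  by rewrite !mulr_ge0 ?powR_ge0.
rewrite /double_term normrM.
have /andP[r10 r1t'] := r1t; have /andP[r20 r2s'] := r2s.
have k : `|kernel_approx alpha n ((p n + q n).-1 - grid n r2 - grid n r1)| <=
    C2 * ((t - r1) `^ (g - 1) * (s - r2) `^ (g - 1)).
  rewrite (le_trans (H2 _ _))// ler_wpM2l//.
  apply: kernel_split => //; rewrite ?subr_gt0//.
  rewrite cut_succ// natrD [leRHS]mulrDl.
  have := grid_gap (ltW r10) h1 (ltW t0).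
  have := grid_gap (ltW r20) h2 (ltW s0).
  by move: ((p n - _)%N%:R / _) ((q n - _)%N%:R / _) => x y; lra.
have c : `|conv_approx alpha b u n (grid n r1) (grid n r2)| <=
    C1 * ((Ct * r1 `^ (e - 1)) * (Cs * r2 `^ (e - 1))).
  rewrite (le_trans (H1 _ _ _))// ler_wpM2l//.
  by apply: ler_pM; rewrite ?powR_ge0//; exact: grid_powR_le.
apply: (le_trans (ler_pM _ _ k c)) => //.
by rewrite le_eqVlt; apply/orP; left; apply/eqP; rewrite /dom; ring.
Qed.

Let J r1 r2 : R := \int[mu]_(v in `]0, u[)
   (scaled_wright alpha b r1 (u - v) * scaled_wright alpha b r2 v)%R.
Let G r1 r2 : R := J r1 r2 * ((t + s - r1 - r2) `^ (1 + alpha))^-1.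

Lemma double_term_cvg r1 r2 : 0 < r1 < t -> 0 < r2 < s ->
  (fun n => double_term n (grid n r1) (grid n r2)) @ \oo --> G r1 r2.
Proof.
move=> /andP[r10 r1t] /andP[r20 r2s].
rewrite /G mulrC; apply: cvgM.
  apply: kernel_approx_cvg => //; first by lra.
  have h : (fun n => ((p n)%:R / n.+1%:R - (grid n r1)%:R / n.+1%:R) +
      ((q n)%:R / n.+1%:R - (grid n r2)%:R / n.+1%:R)) @ \oo -->
      (t - r1) + (s - r2).
    by apply: cvgD; apply: cvgB; apply: cvg_grid; exact: ltW.
  rewrite (_ : t + s - r1 - r2 = (t - r1) + (s - r2)); last by ring.
  apply: cvg_trans h; apply: near_eq_cvg; near=> n.
  have h1 : (grid n r1 < p n)%N.
    by near: n; apply: near_grid_lt (ltW r10) r1t (cvg_grid (ltW t0)).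
  have h2 : (grid n r2 < q n)%N.
    by near: n; apply: near_grid_lt (ltW r20) r2s (cvg_grid (ltW s0)).
  by rewrite cut_succ// natrD !natrB ?(ltnW h1) ?(ltnW h2)//; ring.
by have [] := conv_approx_cvg alpha01 b0 u0 r10 r20 (cvg_gridS (ltW r10)) (cvg_gridS (ltW r20)).
Unshelve. all: by end_near. Qed.

Let p_le n : (p n)%:R / n.+1%:R <= t.
Proof. by have /andP[] := gridP n (ltW t0). Qed.

Let q_le n : (q n)%:R / n.+1%:R <= s.
Proof. by have /andP[] := gridP n (ltW s0). Qed.

Lemma inner_limit r1 : 0 < r1 < t ->
  mu.-integrable `]0, s[ (EFin \o G r1) /\
  (fun n => n.+1%:R^-1 * \sum_(i < q n) double_term n (grid n r1) i) @ \oo -->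
    (\int[mu]_(r2 in `]0, s[) G r1 r2)%R.
Proof.
move=> r1t; have /andP[r10 r1t'] := r1t.
have [C C0 H] := double_term_le.
have mI : measurable (`]0, s[%classic : set (measurableTypeR R)) by [].
apply: (@step_dominated_convergence _ s (fun n => q n)
  (fun n i => double_term n (grid n r1) i) _ (fun r => C * dom t r1 * dom s r)).
- exact: q_le.
- move=> r /andP[r0 rs].
  exact: near_grid_lt (ltW r0) rs (cvg_grid (ltW s0)).
- exact: (integrableZl mI (C * dom t r1) (dom_integrable s0)).
- by move=> r _; rewrite mulr_ge0 ?dom_ge0// mulr_ge0 ?dom_ge0.
- near=> n => r rs h2; rewrite -mulrA; apply: H => //.
  by near: n; apply: near_grid_lt (ltW r10) r1t' (cvg_grid (ltW t0)).
- by move=> r rs; exact: double_term_cvg.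
Unshelve. all: by end_near. Qed.

Lemma outer_limit :
  mu.-integrable `]0, t[ (EFin \o (fun r1 => \int[mu]_(r2 in `]0, s[) G r1 r2)%R) /\
  (fun n => n.+1%:R^-1 * \sum_(l < p n) (n.+1%:R^-1 *
     \sum_(i < q n) double_term n l i)) @ \oo -->
    (\int[mu]_(r1 in `]0, t[) (\int[mu]_(r2 in `]0, s[) G r1 r2))%R.
Proof.
have [C C0 H] := double_term_le.
have mS : measurable (`]0, s[%classic : set (measurableTypeR R)) by [].
have mT : measurable (`]0, t[%classic : set (measurableTypeR R)) by [].
have D0 : 0 <= (\int[mu]_(r in `]0, s[) dom s r)%R.
  by apply: Rintegral_ge0 => r _; exact: dom_ge0.
apply: (@step_dominated_convergence _ t (fun n => p n)
  (fun n l => n.+1%:R^-1 * \sum_(i < q n) double_term n l i) _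
  (fun r => C * (\int[mu]_(r in `]0, s[) dom s r)%R * dom t r)).
- exact: p_le.
- move=> r /andP[r0 rt].
  exact: near_grid_lt (ltW r0) rt (cvg_grid (ltW t0)).
- exact: (integrableZl mT (C * (\int[mu]_(r in `]0, s[) dom s r)%R) (dom_integrable t0)).
- by move=> r _; rewrite mulr_ge0 ?dom_ge0// mulr_ge0.
- apply: nearW => n r rt h1.
  have Di : mu.-integrable `]0, s[ (EFin \o (fun x => C * dom t r * dom s x)).
    exact: (integrableZl mS (C * dom t r) (dom_integrable s0)).
  rewrite (le_trans (step_norm_le (q_le n) Di _ _))//.
  + by move=> x _; rewrite mulr_ge0 ?dom_ge0// mulr_ge0 ?dom_ge0.
  + by move=> x xs h2; rewrite -mulrA; apply: H.
  + rewrite RintegralZl//; last exact: dom_integrable.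
    by rewrite [leLHS]mulrAC.
- by move=> r rt; have [] := inner_limit rt.
Qed.

Lemma wright_double_integralE : wright_double_integral alpha b t s u =
  ((\int[mu]_(r1 in `]0, t[) (\int[mu]_(r2 in `]0, s[) G r1 r2))%R)%:E.
Proof.
rewrite EFin_Rintegral//; last by have [] := outer_limit.
apply: eq_integral => r1; rewrite inE/= in_itv/= => r1t.
rewrite EFin_Rintegral//; last by have [] := inner_limit r1t.
apply: eq_integral => r2; rewrite inE/= in_itv/= => /andP[r20 r2s].
have /andP[r10 _] := r1t.
rewrite /G EFinM; congr (_ * _)%E.
rewrite /J EFin_Rintegral//.
by have [] := conv_approx_cvg alpha01 b0 u0 r10 r20 (cvg_gridS (ltW r10)) (cvg_gridS (ltW r20)).
Qed.

End double_integral_limit.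

(** * The limit of the discrete identities *)

Section limit_identity.
Context {R : realType}.
Notation mu := (@lebesgue_measure R).
Variables (alpha b t s u : R).
Hypotheses (alpha01 : 0 < alpha < 1) (b0 : 0 <= b).
Hypotheses (t0 : 0 < t) (s0 : 0 < s) (u0 : 0 < u).
Local Notation p n := (grid n t).
Local Notation q n := (grid n s).
Local Notation psi := (wright_approx alpha b).

(** The value at v = 0 or v = u of the sum differentiated in discrete_identity:
    one of the two coefficients is taken at time 0. *)
Definition boundary_term n k : R :=
  psi n k u * (n.+1%:R `^ (1 - b) * rising_coef b ((p n + q n).-1 - k)).

(** The sum at v = 0 runs over the indices from p n to p n + q n - 1, whence a
    difference of two sums that start at 0. *)
Lemma rescaled_identity n : (0 < p n)%N ->
  n.+1%:R^-1 * (\sum_(k < p n + q n) boundary_term n k) -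
  n.+1%:R^-1 * (\sum_(k < p n) boundary_term n k) -
  n.+1%:R^-1 * (\sum_(k < q n) boundary_term n k) =
  alpha / Gamma (1 - alpha) * (n.+1%:R^-1 * \sum_(l < p n) (n.+1%:R^-1 *
     \sum_(i < q n) double_term alpha b t s u n l i)).
Proof.
move=> p0; move: (alpha01) => /andP[a0 a1].
have n0 : 0 < n.+1%:R :> R by [].
have G1 : 0 < Gamma (1 - alpha) by rewrite /Gamma subr_gt0 a1 euler_integral_gt0// subr_gt0.
set N : R := n.+1%:R; pose X := N `^ (1 - b); pose kappa := N `^ alpha.
rewrite big_split_ord/= mulrDr [X in X - _ - _]addrC addrK.
have h := discrete_identity alpha01 b kappa (q n) p0 u0.
rewrite /= in h.
transitivity (N^-1 * (X * X) * (\sum_(i < q n) rising_coef b i *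
    stable_coef alpha b ((p n + q n).-1 - i) (u * kappa) -
   \sum_(i < q n) stable_coef alpha b i (u * kappa) * rising_coef b ((p n + q n).-1 - i))).
  rewrite mulrBr -!mulrA; congr (_ * _ - _ * _); rewrite mulrA mulr_sumr.
    rewrite (reindex_inj rev_ord_inj)/=; apply: eq_bigr => i _.
    have e1 : (p n + (q n - i.+1))%N = ((p n + q n).-1 - i)%N by have := ltn_ord i; lia.
    have e2 : ((p n + q n).-1 - ((p n + q n).-1 - i))%N = i by have := ltn_ord i; lia.
    rewrite /boundary_term e1 e2 /wright_approx -/N -/X -/kappa; ring.
  apply: eq_bigr => i _.
  by rewrite /boundary_term /wright_approx -/N -/X -/kappa; ring.
rewrite h exchange_big/= !mulr_sumr; apply: eq_bigr => l _.
rewrite !mulr_sumr; apply: eq_bigr => i _.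
have -> : double_term alpha b t s u n l i = N * kappa * (Gamma (- alpha) *
    rising_coef (- alpha) ((p n + q n).-1 - i - l)) * (X * X *
    (\int[mu]_(v in `]0, u[) (stable_coef alpha b i (v * kappa) *
       stable_coef alpha b l ((u - v) * kappa)))%R).
  rewrite /double_term /kernel_approx -/N powRD; last by rewrite (gt_eqF n0) implybT.
  rewrite powRr1 ?(ltW n0)// -/kappa; congr (_ * _).
  rewrite /conv_approx -RintegralZl//; last exact: integrable_stable_coef_prod.
  apply: eq_Rintegral => v _; rewrite /wright_approx -/N -/X -/kappa; ring.
rewrite Gamma_opp//.
by field; rewrite !gt_eqF.
Qed.


Let boundary r : R :=
  (t + s - r) `^ (b - 1) / Gamma b * scaled_wright alpha b r u.

Let ts0 : 0 < t + s. Proof. exact: addr_gt0. Qed.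

Let pq_le n : (p n + q n)%N%:R / n.+1%:R <= t + s.
Proof.
have /andP[h1 _] := gridP n (ltW t0); have /andP[h2 _] := gridP n (ltW s0).
by rewrite natrD mulrDl lerD.
Qed.

Let pq_cvg : (fun n => (p n + q n)%N%:R / n.+1%:R) @ \oo --> t + s.
Proof.
apply: cvg_trans (cvgD (cvg_grid (ltW t0)) (cvg_grid (ltW s0))).
by apply: near_eq_cvg; apply: nearW => n /=; rewrite natrD mulrDl.
Qed.

Let cut_gap n k r : (k < p n + q n)%N -> k%:R / n.+1%:R <= r ->
  (t + s - r) / 3 <= ((p n + q n).-1 - k).+1%:R / n.+1%:R <= t + s.
Proof.
move=> kpq kr.
have -> : ((p n + q n).-1 - k).+1 = (p n + q n - k)%N by lia.
have /andP[_ h1] := gridP n (ltW t0); have /andP[_ h2] := gridP n (ltW s0).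
have h3 : 1 / n.+1%:R <= (p n + q n - k)%N%:R / n.+1%:R :> R.
  by rewrite ler_wpM2r ?invr_ge0// ler1n subn_gt0.
have h4 := pq_le n; have h5 : 0 <= k%:R / n.+1%:R :> R by rewrite divr_ge0.
rewrite natrB ?(ltnW kpq)// natrD !mulrBl !mulrDl in h3 h4 *.
rewrite -[(p n).+1%:R]natr1 mulrDl in h1; rewrite -[(q n).+1%:R]natr1 mulrDl in h2.
move: h1 h2 h3 h4 h5 kr.
move: (1 / _) ((p n)%:R / _) ((q n)%:R / _) (k%:R / _) => w x y z.
by move=> *; apply/andP; split; lra.
Qed.

Let e : R := Num.min (b + alpha / 2) 1.
Let f : R := Num.min b 1.
Let dom r : R := r `^ (e - 1) * (t + s - r) `^ (f - 1).

(** The constant 3: (p n + q n) - k is at least 1 and falls short of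
    (n + 1) (t + s - r) by at most 2. *)
Lemma boundary_term_le : exists2 C, 0 <= C & forall n r, 0 < r < t + s ->
  (grid n r < p n + q n)%N -> `|boundary_term n (grid n r)| <= C * dom r.
Proof.
have [C1 C10 H1] := wright_approx_le alpha01 b0.
have [C2 C20 H2] := rising_coef_le b.
pose A1 := C1 * (t + s) `^ (b + alpha / 2 - e) * u `^ (2^-1 - 1).
pose A2 := C2 * (t + s) `^ (b - f) * 3^-1 `^ (f - 1).
exists (A1 * A2) => [|n r /andP[r0 rts] gr]; first by rewrite !mulr_ge0 ?powR_ge0.
have n0 : 0 < n.+1%:R :> R by [].
have /andP[g1 g2] := gridP n (ltW r0).
have /andP[c1 c2] := cut_gap gr g1.
have h1 : psi n (grid n r) u <= A1 * r `^ (e - 1).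
  rewrite (le_trans (H1 n _ _ u0))// /A1 [leRHS]mulrAC ler_wpM2r ?powR_ge0//.
  rewrite -[leRHS]mulrA ler_wpM2l//; apply: powR_cap => //; first exact: ltW.
  by rewrite (le_trans _ (pq_le n))// ler_wpM2r ?invr_ge0// ler_nat.
have h2 : n.+1%:R `^ (1 - b) * `|rising_coef b ((p n + q n).-1 - grid n r)| <=
    A2 * (t + s - r) `^ (f - 1).
  set k := ((p n + q n).-1 - grid n r)%N in c1 c2 *.
  apply: (@le_trans _ _ (C2 * (k.+1%:R / n.+1%:R) `^ (b - 1))).
    rewrite powRM ?invr_ge0//.
    have -> : n.+1%:R^-1 `^ (b - 1) = n.+1%:R `^ (1 - b) :> R.
      by rewrite -powR_inv1 ?ltW// -powRrM mulN1r opprB.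
    by rewrite mulrA mulrC ler_wpM2r ?powR_ge0.
  rewrite /A2 -!mulrA ler_wpM2l//.
  have trs : 0 < t + s - r by rewrite subr_gt0.
  rewrite -powRM ?invr_ge0 ?(ltW trs)// [3^-1 * _]mulrC.
  by apply: powR_cap => //; rewrite divr_gt0.
rewrite /boundary_term normrM [`|_ * rising_coef _ _|]normrM.
rewrite [`|n.+1%:R `^ _|]ger0_norm ?powR_ge0// ger0_norm ?wright_approx_ge0 ?(ltW u0)//.
rewrite [leRHS](_ : _ = A1 * r `^ (e - 1) * (A2 * (t + s - r) `^ (f - 1))); last first.
  by rewrite /dom; ring.
by apply: ler_pM; rewrite ?wright_approx_ge0 ?mulr_ge0 ?powR_ge0 ?(ltW u0).
Qed.

Lemma boundary_term_cvg r : 0 < r < t + s ->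
  (fun n => boundary_term n (grid n r)) @ \oo --> boundary r.
Proof.
move=> /andP[r0 rts]; rewrite /boundary mulrC; apply: cvgM.
  by apply: stable_coef_cvg => //; apply: cvg_gridS; exact: ltW.
apply: rising_coef_scaled; first by rewrite subr_gt0.
apply: cvg_trans (cvgB pq_cvg (cvg_grid (ltW r0))).
apply: near_eq_cvg; near=> n => /=.
have h : (grid n r < p n + q n)%N.
  by near: n; apply: near_grid_lt (ltW r0) rts pq_cvg.
rewrite -[LHS]/((p n + q n)%:R / n.+1%:R - (grid n r)%:R / n.+1%:R).
rewrite -mulrBl -natrB ?(ltnW h)//; congr (_%:R / _); lia.
Unshelve. all: by end_near. Qed.

Hypothesis b1 : 0 < b.

Lemma boundary_limit (B : R) (h : nat -> nat) : 0 < B -> B <= t + s ->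
  (forall n, (h n <= p n + q n)%N) -> (forall n, (h n)%:R / n.+1%:R <= B) ->
  (fun n => (h n)%:R / n.+1%:R) @ \oo --> B ->
  mu.-integrable `]0, B[ (EFin \o boundary) /\
  (fun n => n.+1%:R^-1 * \sum_(k < h n) boundary_term n k) @ \oo -->
    (\int[mu]_(r in `]0, B[) boundary r)%R.
Proof.
move=> B0 Bts hpq hB hcv; move: (alpha01) => /andP[a0 a1].
have [C C0 H] := boundary_term_le.
have mB : measurable (`]0, B[%classic : set (measurableTypeR R)) by [].
have inB r : 0 < r < B -> 0 < r < t + s.
  by move=> /andP[-> rB]; rewrite (lt_le_trans rB).
have di : mu.-integrable `]0, B[ (EFin \o dom).
  have : mu.-integrable `]0, (t + s)[ (EFin \o dom).
    apply: integrable_beta => //.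
      by rewrite lt_min ltr01 andbT ge_min lexx orbT andbT ltr_wpDl// divr_gt0.
    by rewrite lt_min ltr01 b1 ge_min lexx orbT.
  by apply: integrableS => //; apply: subset_itvl; rewrite bnd_simp.
apply: (@step_dominated_convergence _ B h boundary_term _ (fun r => C * dom r)) => //.
- by move=> r /andP[r0 rB]; exact: near_grid_lt (ltW r0) rB hcv.
- exact: (integrableZl mB C di).
- by move=> r _; rewrite mulr_ge0// /dom mulr_ge0 ?powR_ge0.
- apply: nearW => n r /inB rB gr; apply: H => //.
  exact: leq_trans gr (hpq n).
- by move=> r /inB; exact: boundary_term_cvg.
Qed.

End limit_identity.

Section identities.
Context {R : realType}.
Notation mu := (@lebesgue_measure R).
Variables (alpha t s u : R).
Hypotheses (alpha01 : 0 < alpha < 1) (t0 : 0 < t) (s0 : 0 < s) (u0 : 0 < u).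

(** The three integrals are the limits of the three sums of rescaled_identity. *)
Lemma wright_level_crossing b : 0 < b ->
  let F := fun r : R =>
    (t + s - r) `^ (b - 1) / Gamma b * scaled_wright alpha b r u in
  mu.-integrable `]0, (t + s)[ (EFin \o F) /\
  (((\int[mu]_(r in `]0, (t + s)[) F r)%R - (\int[mu]_(r in `]0, t[) F r)%R
     - (\int[mu]_(r in `]0, s[) F r)%R)%:E
   = (alpha / Gamma (1 - alpha))%:E * wright_double_integral alpha b t s u)%E.
Proof.
move=> b1 F; have b0 := ltW b1.
have tle n : (grid n t)%:R / n.+1%:R <= t by have /andP[] := gridP n (ltW t0).
have sle n : (grid n s)%:R / n.+1%:R <= s by have /andP[] := gridP n (ltW s0).
have [F1 L1] : mu.-integrable `]0, (t + s)[ (EFin \o F) /\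
  (fun n => n.+1%:R^-1 * \sum_(k < grid n t + grid n s) boundary_term alpha b t s u n k) @ \oo
    --> (\int[mu]_(r in `]0, (t + s)[) F r)%R.
  apply: (@boundary_limit _ _ _ _ _ _ alpha01 b0 t0 s0 u0 b1) => //; first exact: addr_gt0.
  - by move=> n; rewrite natrD mulrDl lerD.
  - apply: cvg_trans (cvgD (cvg_grid (ltW t0)) (cvg_grid (ltW s0))).
    by apply: near_eq_cvg; apply: nearW => n /=; rewrite natrD mulrDl.
have [_ L2] := @boundary_limit _ _ _ _ _ _ alpha01 b0 t0 s0 u0 b1 t (fun n => grid n t)
  t0 (ltW (ltr_pwDr s0 (lexx t))) (fun n => leq_addr _ _) tle (cvg_grid (ltW t0)).
have [_ L3] := @boundary_limit _ _ _ _ _ _ alpha01 b0 t0 s0 u0 b1 s (fun n => grid n s)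
  s0 (ltW (ltr_pwDl t0 (lexx s))) (fun n => leq_addl _ _) sle (cvg_grid (ltW s0)).
split=> //.
rewrite (wright_double_integralE alpha01 b0 t0 s0 u0) -EFinM; congr EFin.
have [_ LW] := outer_limit alpha01 b0 t0 s0 u0.
pose v n : R :=
  n.+1%:R^-1 * (\sum_(k < grid n t + grid n s) boundary_term alpha b t s u n k) -
  n.+1%:R^-1 * (\sum_(k < grid n t) boundary_term alpha b t s u n k) -
  n.+1%:R^-1 * (\sum_(k < grid n s) boundary_term alpha b t s u n k).
have L : v @ \oo --> (\int[mu]_(r in `]0, (t + s)[) F r)%R -
    (\int[mu]_(r in `]0, t[) F r)%R - (\int[mu]_(r in `]0, s[) F r)%R.
  by apply: cvgB => //; exact: cvgB.
rewrite -(cvg_lim (@Rhausdorff R) L); apply: cvg_lim; first exact: Rhausdorff.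
apply: cvg_trans (cvgMr (a := alpha / Gamma (1 - alpha)) LW); apply: near_eq_cvg.
have := near_grid_lt (lexx 0) t0 (cvg_grid (ltW t0)); apply: filterS => n pn.
rewrite /v (rescaled_identity alpha01 b0 t0 s0 u0)//.
exact: leq_ltn_trans pn.
Qed.

(** For b = 0 the coefficients at time 0 are those of the constant 1: only the
    term of index p n + q n - 1 of the longest sum survives. *)
Lemma wright_level_crossing_density :
  ((scaled_wright alpha 0 (t + s) u)%:E
   = (alpha / Gamma (1 - alpha))%:E * wright_double_integral alpha 0 t s u)%E.
Proof.
have b0 : 0 <= 0 :> R by [].
rewrite (wright_double_integralE alpha01 b0 t0 s0 u0) -EFinM; congr EFin.
have [_ LW] := outer_limit alpha01 b0 t0 s0 u0.
have ts0 : 0 < t + s by rewrite addr_gt0.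
have pq1 : (fun n => (grid n t + grid n s).-1.+1%:R / n.+1%:R) @ \oo --> t + s.
  apply: cvg_trans (cvgD (cvg_grid (ltW t0)) (cvg_grid (ltW s0))).
  apply: near_eq_cvg.
  have := near_grid_lt (lexx 0) t0 (cvg_grid (ltW t0)); apply: filterS => n pn.
  by rewrite /= prednK ?natrD ?mulrDl// addn_gt0 (leq_ltn_trans _ pn).
have L := @stable_coef_cvg _ alpha 0 (t + s) u _ alpha01 b0 ts0 pq1.
rewrite -(cvg_lim (@Rhausdorff R) L); apply: cvg_lim; first exact: Rhausdorff.
apply: cvg_trans (cvgMr (a := alpha / Gamma (1 - alpha)) LW); apply: near_eq_cvg.
near=> n.
have pn : (0 < grid n t)%N.
  apply: leq_ltn_trans (leq0n (grid n 0)) _.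
  by near: n; exact: near_grid_lt (lexx 0) t0 (cvg_grid (ltW t0)).
have qn : (0 < grid n s)%N.
  apply: leq_ltn_trans (leq0n (grid n 0)) _.
  by near: n; exact: near_grid_lt (lexx 0) s0 (cvg_grid (ltW s0)).
rewrite /= -(rescaled_identity alpha01 b0 t0 s0 u0)//.
have n0 : 0 < n.+1%:R :> R by [].
have z k : (k < (grid n t + grid n s).-1)%N -> boundary_term alpha 0 t s u n k = 0.
  move=> h; rewrite /boundary_term rising_coef_0 subn_eq0 leqNgt h /=.
  by rewrite mulr0 mulr0.
have [m Em] : exists m, (grid n t + grid n s)%N = m.+1.
  by exists (grid n t + grid n s).-1; lia.
rewrite Em big_ord_recr/= !big1 ?mulr0 ?subr0 ?add0r.
- rewrite /boundary_term Em /= subnn rising_coef0 mulr1 /wright_approx subr0 powRr1 ?(ltW n0)//.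
  by rewrite mulrC mulfK// gt_eqF.
- by move=> i _; apply: z; rewrite (leq_trans (ltn_ord i))//; lia.
- by move=> i _; apply: z; rewrite (leq_trans (ltn_ord i))//; lia.
- by move=> i _; apply: z; rewrite Em/=.
Unshelve. all: by end_near. Qed.

End identities.

Theorem proposition5 (R : realType) (alpha beta t s : R)
    (halpha0 : 0 < alpha) (halpha1 : alpha < 1) (hbeta : alpha < beta)
    (ht : 0 < t) (hs : 0 < s) (u : R) (hu : 0 < u) :
  let F := fun r : R =>
    (t + s - r) `^ (beta - alpha - 1) / Gamma (beta - alpha)
      * scaled_wright alpha (beta - alpha) r u in
  [/\ (* the two integrals on the left-hand side of (i) converge *)
      (@lebesgue_measure R).-integrable `]t, t + s[ (EFin \o F),
      (@lebesgue_measure R).-integrable `]0, s[ (EFin \o F),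
      (* (i) *)
      (\int[@lebesgue_measure R]_(r in `]t, (t + s)%R[) (F r)%:E
         - \int[@lebesgue_measure R]_(r in `]0%R, s[) (F r)%:E
       = (alpha / Gamma (1 - alpha))%:E
         * wright_double_integral alpha (beta - alpha) t s u)%E
    & (* (ii) *)
      ((scaled_wright alpha 0 (t + s) u)%:E
       = (alpha / Gamma (1 - alpha))%:E
         * wright_double_integral alpha 0 t s u)%E].
Proof.
move=> F.
have alpha01 : 0 < alpha < 1 by rewrite halpha0.
have b0 : 0 < beta - alpha by rewrite subr_gt0.
have [FI FE] := wright_level_crossing alpha01 ht hs hu b0.
rewrite -/F in FI FE.
have Ft : (@lebesgue_measure R).-integrable `]t, t + s[ (EFin \o F).
  by apply: integrableS FI => //; apply: subset_itvr; rewrite bnd_simp ltW.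
have Fs : (@lebesgue_measure R).-integrable `]0, s[ (EFin \o F).
  by apply: integrableS FI => //; apply: subset_itvl; rewrite bnd_simp lerDr ltW.
have F0t : (@lebesgue_measure R).-integrable `]0, t[ (EFin \o F).
  by apply: integrableS FI => //; apply: subset_itvl; rewrite bnd_simp lerDl ltW.
split; [exact: Ft|exact: Fs| |exact: wright_level_crossing_density].
rewrite -FE -!EFin_Rintegral// -EFinB; congr (_ - _)%:E.
rewrite (Rintegral_itv_bndo_bndc F0t) Rintegral_itvB//.
- by rewrite bnd_simp ltW.
- by rewrite bnd_simp ltrDl.
Qed.
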